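(* Let $0<a<b<\infty$, $\Delta=[a,b]$, $\Psi\in C^{1}(\Delta,\mathbb{R})$ increasing with $\Psi'\neq0$ on $\Delta$, $0<\mu<1$, $0\le\nu\le1$, $\rho=\mu+\nu-\mu\nu$. Let $f:(a,b]\times\mathbb{R}\to\mathbb{R}$ be such that $f(\cdot,y(\cdot))\in\mathbf{C}_{1-\rho;\Psi}(\Delta,\mathbb{R})$ for every $y\in\mathbf{C}_{1-\rho;\Psi}(\Delta,\mathbb{R})$ and $|f(t,y_1)-f(t,y_2)|\le L|y_1-y_2|$ for all $t\in(a,b]$, $y_1,y_2\in\mathbb{R}$, where $L>0$ is a constant. Then for every $\epsilon>0$, if $y^*\in\mathbf{C}_{1-\rho;\Psi}(\Delta,\mathbb{R})$ satisfies $$\left|^H\mathbf{D}^{\mu,\nu;\Psi}_{a^+}y^*(t)-f(t,y^*(t))\right|\le\epsilon,\quad t\in\Delta,$$ then there exists a solution $y\in\mathbf{C}_{1-\rho;\Psi}(\Delta,\mathbb{R})$ of $^H\mathbf{D}^{\mu,\nu;\Psi}_{a^+}y(t)=f(t,y(t))$ with $\mathbf{I}^{1-\rho;\Psi}_{a^+}y^*(a)=\mathbf{I}^{1-\rho;\Psi}_{a^+}y(a)$ such that $$\|y^*-y\|_{\mathbf{C}_{1-\rho;\Psi}}\le\left(\frac{E_\mu\big(L(\Psi(b)-\Psi(a))^\mu\big)-1}{L}(\Psi(b)-\Psi(a))^{1-\rho}\right)\epsilon.$$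
   Context: $\mathbf{C}_{1-\rho;\Psi}(\Delta,\mathbb{R})=\{h:(a,b]\to\mathbb{R}: (\Psi(t)-\Psi(a))^{1-\rho}h(t)\in C(\Delta,\mathbb{R})\}$ with norm $\|h\|_{\mathbf{C}_{1-\rho;\Psi}}=\max_{t\in\Delta}|(\Psi(t)-\Psi(a))^{1-\rho}h(t)|$. $\mathbf{I}^{\alpha;\Psi}_{a^+}h(t)=\frac{1}{\Gamma(\alpha)}\int_a^t\Psi'(\eta)(\Psi(t)-\Psi(\eta))^{\alpha-1}h(\eta)\,d\eta$ for $\alpha>0$. $^H\mathbf{D}^{\mu,\nu;\Psi}_{a^+}h=\mathbf{I}^{\nu(1-\mu);\Psi}_{a^+}\left(\frac{1}{\Psi'(t)}\frac{d}{dt}\right)\mathbf{I}^{(1-\nu)(1-\mu);\Psi}_{a^+}h$ ($\Psi$-Hilfer derivative). A solution $y$ of the equation with $\mathbf{I}^{1-\rho;\Psi}_{a^+}y(a)=c$ is a $y\in\mathbf{C}_{1-\rho;\Psi}(\Delta,\mathbb{R})$ satisfying $y(t)=\frac{(\Psi(t)-\Psi(a))^{\rho-1}}{\Gamma(\rho)}c+\mathbf{I}^{\mu;\Psi}_{a^+}f(\cdot,y(\cdot))(t)$ on $(a,b]$. $E_\mu(z)=\sum_{k=0}^\infty\frac{z^k}{\Gamma(k\mu+1)}$ is the one-parameter Mittag-Leffler function. *)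

(* Defs.v *)
From HB Require Import structures.
From mathcomp Require Import all_boot all_order all_algebra.
From mathcomp Require Import all_classical all_reals all_analysis.
Set Implicit Arguments. Unset Strict Implicit. Unset Printing Implicit Defensive.
Import Order.TTheory GRing.Theory Num.Theory.
Import numFieldNormedType.Exports.
Local Open Scope classical_set_scope.
Local Open Scope ring_scope.

Section Defs.
Variable R : realType.

Definition Gamma (x : R) : R :=
  Rintegral lebesgue_measure `]0, +oo[ (fun s : R => s `^ (x - 1) * expR (- s)).

Definition mittag_leffler (mu z : R) : R :=
  limn (series (fun k : nat => z ^+ k / Gamma (k%:R * mu + 1))).

(* Psi-Riemann-Liouville fractional integral of order alpha >= 0
   (order 0 is the identity, by the usual convention):
   I^{alpha;Psi}_{a+} h (t) =
     1/Gamma(alpha) int_a^t Psi'(s) (Psi t - Psi s)^(alpha-1) h(s) ds. *)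
Definition RL_int (Psi : R -> R) (a alpha : R) (h : R -> R) (t : R) : R :=
  if alpha == 0 then h t else
  (Gamma alpha)^-1 *
    Rintegral lebesgue_measure `[a, t]
      (fun s : R => derive1 Psi s * (Psi t - Psi s) `^ (alpha - 1) * h s).

Definition hilfer_deriv (Psi : R -> R) (a mu nu : R) (h : R -> R) : R -> R :=
  RL_int Psi a (nu * (1 - mu))
    (fun t => derive1 (RL_int Psi a ((1 - nu) * (1 - mu)) h) t / derive1 Psi t).

Definition hilfer_derivable (Psi : R -> R) (a b mu nu : R) (h : R -> R) : Prop :=
  forall t, a < t < b ->
    derivable (RL_int Psi a ((1 - nu) * (1 - mu)) h) t 1 /\
    (0 < nu * (1 - mu) ->
      lebesgue_measure.-integrable `[a, t]
        (fun s : R => (derive1 Psi s * (Psi t - Psi s) `^ (nu * (1 - mu) - 1) *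
           (derive1 (RL_int Psi a ((1 - nu) * (1 - mu)) h) s / derive1 Psi s))%:E)).

Definition wspace (Psi : R -> R) (a b g : R) (h : R -> R) : Prop :=
  exists F : R -> R, {within `[a, b], continuous F} /\
    forall t, a < t <= b -> F t = (Psi t - Psi a) `^ g * h t.

(* I^{1-rho;Psi}_{a+} h (a), understood as the right limit at a. *)
Definition init_val (Psi : R -> R) (a g : R) (h : R -> R) : R :=
  lim (RL_int Psi a g h @ a^'+).

End Defs.

(* Main.v *)
(* Through the increasing change of variable x = Psi t - Psi a, the fractional
   integrals become convolutions with x^(al-1) / Gamma(al) on ]0, X], where
   X = Psi b - Psi a, and the semigroup law I^al I^be = I^(al+be) is Fubini plus
   the Beta integral.

   Let rho = mu + be, with be = nu (1 - mu), let w be the derivative of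
   I^(1-rho) ystar and c its initial value.  Nothing is known of w beyond
   measurability, the existence of I^be w, and |I^be w - f(., ystar)| <= eps, but
   this makes w integrable on ]0, x] for x < X, so that I^(1-rho) ystar = c + I^1 w
   by the fundamental theorem of calculus for everywhere derivable functions.
   Applying I^rho gives
     I^1 (ystar - c x^(rho-1)/Gamma(rho) - I^mu f(., ystar))
       = I^(1+mu) (I^be w - f(., ystar)),
   whose increments are dominated by those of eps I^(1+mu) 1.  As the integrand on
   the left is continuous, it is at most eps x^mu / Gamma(mu+1) in absolute value.

   Picard iteration started at ystar then yields a solution: the n-th step is at
   most eps L^n x^((n+1)mu) / Gamma((n+1)mu+1), and these bounds sum up to
   eps (E_mu (L x^mu) - 1) / L. *)
Require Import Defs.
From HB Require Import structures.
From mathcomp Require Import all_boot all_order all_algebra.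
From mathcomp Require Import all_classical all_reals all_analysis.
From mathcomp Require Import measurable_realfun ring lra.
Import Order.TTheory GRing.Theory Num.Theory.
Import numFieldNormedType.Exports.
Local Open Scope classical_set_scope.
Local Open Scope ring_scope.
Set Implicit Arguments.
Unset Strict Implicit.
Unset Printing Implicit Defensive.

(** * Change of variable along an increasing bijection of the line *)

(** The residual [I^be w - f(., ystar)] is only known to be measurable and bounded, so the identity
    between its fractional integral and that of the left-hand side cannot simply be differentiated.
    As 1 + mu >= 1, the kernel of I^(1+mu) is nondecreasing and its increments are nonnegative
    weights: this is why a pointwise bound on the residual survives as a bound on increments.
    Continuity of the left integrand then turns increments back into a pointwise bound, and also
    carries it to x = X, where the differential inequality is not assumed.

    Kernels vanish on the nonpositive half-line, so fractional integrals are taken over the whole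
    line and Fubini involves no domains. All bounds are multiples of the normalized powers x^(a-1) /
    Gamma(a), a family in which I^mu moves a to a + mu; this is where the numbers Gamma((n+1)mu+1)
    come from. *)

Section change_of_variable.
Context {R : realType}.
Notation mu := (@lebesgue_measure R).
Variables P p : R -> R.
Hypothesis ndP : {mono P : x y / x <= y}.
Hypothesis surjP : forall y, exists x, P x = y.
Hypothesis mp : measurable_fun [set: R] p.
Hypothesis p0 : forall t, 0 <= p t.
Hypothesis intp : forall s t, s <= t ->
  (\int[mu]_(u in `]s, t]) (p u)%:E = (P t - P s)%:E)%E.

Let mP : measurable_fun [set: R] P.
Proof.
apply: nondecreasing_measurable => //.
by move=> x y; rewrite ndP.
Qed.

(** The pushforward by [P] of the measure with density [p]. *)
Definition weighted_preimage (A : set (measurableTypeR R)) : \bar R :=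
  (\int[mu]_(t in P @^-1` A) (p t)%:E)%E.

Let weighted_preimage0 : weighted_preimage set0 = 0%E.
Proof. by rewrite /weighted_preimage preimage_set0 integral_set0. Qed.

Let weighted_preimage_ge0 A : (0 <= weighted_preimage A)%E.
Proof. by apply: integral_ge0 => t _; rewrite lee_fin p0. Qed.

Let measurable_preimage A : measurable A -> measurable (P @^-1` A).
Proof. by move=> mA; rewrite -[X in measurable X]setTI; exact: mP. Qed.

Let weighted_preimage_sigma_additive : semi_sigma_additive weighted_preimage.
Proof.
move=> F mF tF mUF; rewrite /weighted_preimage preimage_bigcup.
rewrite ge0_integral_bigcup//.
- apply: is_cvg_nneseries => n _ _; exact: weighted_preimage_ge0.
- by move=> n; exact: (measurable_preimage (mF n)).
- by apply/measurable_EFinP; apply: measurable_funTS.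
- by move=> x _; rewrite lee_fin p0.
- apply/trivIsetP => /= i j _ _ ij; rewrite -preimage_setI.
  by move/trivIsetP : tF => /(_ _ _ _ _ ij) ->//; rewrite preimage_set0.
Qed.

HB.instance Definition _ := isMeasure.Build _ _ _ weighted_preimage
  weighted_preimage0 weighted_preimage_ge0 weighted_preimage_sigma_additive.

(** Lebesgue measure is determined by its values on half-open intervals. By surjectivity their
    endpoints are values of [P], and [intp] computes the mass. *)
Let weighted_preimageE (A : set R) : measurable A -> mu A = weighted_preimage A.
Proof.
move: A; apply: (@lebesgue_measure_unique R weighted_preimage) => X /ocitvP[->|[[x y] /= xy ->]].
  by rewrite !measure0.
have [s Ps] := surjP x; have [t Pt] := surjP y.
have st : s <= t by rewrite -ndP Ps Pt ltW.
transitivity ((y - x)%:E : \bar R).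
  by rewrite lebesgue_measure_itv/= lte_fin xy.
rewrite /weighted_preimage -Ps -Pt.
rewrite -intp//; congr (integral _ _ _).
apply/seteqP; split => u /=; rewrite !in_itv/= !ltNge !ndP//.
Qed.

Import HBNNSimple.

(** Equality of the two measures gives the formula for indicators, hence for simple functions, and
    monotone convergence does the rest. [P] and [p] are linked by [intp] rather than by a
    derivative, so [P] may have corners, as [ext] below may at a and b. *)
Lemma ge0_integral_change_of_variable (g : R -> \bar R) :
  measurable_fun [set: R] g -> (forall x, 0 <= g x)%E ->
  (\int[mu]_x g x = \int[mu]_t (g (P t) * (p t)%:E))%E.
Proof.
move=> mg g0.
pose h := nnsfun_approx measurableT mg.
have hE x : g x = limn (fun n => (h n x)%:E).
  by apply/esym/cvg_lim => //; exact: cvg_nnsfun_approx.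
have hcvg x : (h n x)%:E @[n --> \oo] --> g x by exact: cvg_nnsfun_approx.
have ndh (x : R) a b : (a <= b)%N -> h a x <= h b x.
  by move=> ab; exact/lefP/nd_nnsfun_approx.
have mh n : measurable_fun [set: R] (h n) by exact: measurable_funPT.
have -> : (\int[mu]_x g x = limn (fun n => \int[mu]_x (h n x)%:E))%E.
  under eq_integral do rewrite hE.
  apply: monotone_convergence => //.
  - by move=> n; apply/measurable_EFinP; exact: mh.
  - by move=> n x _; rewrite lee_fin.
  - by move=> x _ a b ab; rewrite lee_fin; exact: ndh.
have -> : (\int[mu]_t (g (P t) * (p t)%:E) =
    limn (fun n => \int[mu]_t ((h n (P t))%:E * (p t)%:E)))%E.
  have gE t : (g (P t) * (p t)%:E = limn (fun n => (h n (P t))%:E * (p t)%:E))%E.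
    by apply/esym/cvg_lim => //; apply: cvgeZr.
  under eq_integral do rewrite gE.
  apply: monotone_convergence => //.
  - move=> n; apply/measurable_EFinP; apply: measurable_funM => //.
    exact: measurableT_comp.
  - by move=> n x _; rewrite lee_fin mulr_ge0.
  - by move=> x _ a b ab; rewrite lee_fin ler_wpM2r// ndh.
congr (limn _); apply/funext => n.
transitivity (\int[mu]_x
   (\sum_(y \in range (h n)) (y * \1_(h n @^-1` [set y]) x)%:E))%E.
  by apply: eq_integral => t tE; rewrite /= fimfunE -fsumEFin.
have indich r : measurable_fun [set: R] (fun x => (r * \1_(h n @^-1` [set r]) x)%:E).
  by apply: (measurable_comp measurableT) => //; exact: measurable_funM.
rewrite ge0_integral_fsum//; last by move=> m y Ey; exact: nnfun_muleindic_ge0.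
transitivity (\int[mu]_x (\sum_(y \in range (h n))
    (y * \1_(h n @^-1` [set y]) (P x))%:E * (p x)%:E))%E; last first.
  under [RHS]eq_integral => x xE.
    rewrite fimfunE -fsumEFin// ge0_mule_fsuml => [|y]; last exact: nnfun_muleindic_ge0.
    over.
  by [].
rewrite ge0_integral_fsum//; last 2 first.
  - move=> y; apply/emeasurable_funM; last exact/measurable_EFinP.
    by apply: (measurableT_comp (indich y)).
  - move=> m y _; apply: mule_ge0; last by rewrite lee_fin.
    by rewrite EFinM; exact: nnfun_muleindic_ge0.
apply: eq_fsbigr => r rhn.
have r0 : 0 <= r by move: rhn; rewrite inE => -[x _ <-].
under eq_integral do rewrite EFinM.
under [RHS]eq_integral do rewrite EFinM -muleA.
have mI : measurable_fun [set: R] (\1_(h n @^-1` [set r]) : R -> R) by [].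
have mIE : measurable_fun [set: R] (fun x : R => (\1_(h n @^-1` [set r]) x : R)%:E).
  exact/measurable_EFinP.
have mIP : measurable_fun [set: R]
    (fun x : R => (\1_(h n @^-1` [set r]) (P x) : R)%:E * (p x)%:E)%E.
  by apply/measurable_EFinP/measurable_funM => //; exact: (measurableT_comp mI).
rewrite ge0_integralZl// ge0_integralZl//; last first.
  by move=> x _; rewrite mule_ge0// lee_fin.
congr (_ * _)%E.
have mh1 : measurable (h n @^-1` [set r] : set (measurableTypeR R)).
  by rewrite -[X in measurable X]setTI; exact: mh.
rewrite integral_indic; [|by []|exact: mh1]; rewrite setIT.
transitivity (weighted_preimage (h n @^-1` [set r])).
  exact: weighted_preimageE.
rewrite /weighted_preimage [LHS]integral_mkcond.
apply: eq_integral => x _.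
rewrite patchE/= indicE (_ : (x \in _) = (P x \in h n @^-1` [set r]))//.
by case: (P x \in _); rewrite ?mul1e ?mul0e.
Qed.

Lemma integral_change_of_variable (g : R -> R) :
  measurable_fun [set: R] g ->
  (\int[mu]_x (g x)%:E = \int[mu]_t (g (P t) * p t)%:E)%E.
Proof.
move=> mg; rewrite integralE [RHS]integralE.
congr (_ - _)%E.
- rewrite ge0_integral_change_of_variable//; last first.
    exact/measurable_funepos/measurable_EFinP.
  apply: eq_integral => t _; rewrite !funeposE EFinM [in RHS]muleC.
  by rewrite muleC maxe_pMr// ?mule0// lee_fin.
- rewrite ge0_integral_change_of_variable//; last first.
    exact/measurable_funeneg/measurable_EFinP.
  apply: eq_integral => t _; rewrite !funenegE EFinM [in RHS]muleC.
  by rewrite muleC -muleN maxe_pMr// ?mule0// lee_fin.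
Qed.

End change_of_variable.

(** * The Gamma integral *)
Section gamma.
Context {R : realType}.
Notation mu := (@lebesgue_measure R).

Lemma ge0_integral_shift (c : R) (g : R -> \bar R) :
  measurable_fun [set: R] g -> (forall x, 0 <= g x)%E ->
  (\int[mu]_x g x = \int[mu]_x g (x - c)%R)%E.
Proof.
move=> mg g0.
rewrite (@ge0_integral_change_of_variable R (fun x => x - c) (fun=> 1))//.
- by apply: eq_integral => x _; rewrite mule1.
- by move=> x y; rewrite /= lerD2r.
- by move=> y; exists (y + c); rewrite addrK.
- move=> s t st; rewrite integral_cst//= lebesgue_measure_itv/= lte_fin mul1e.
  have -> : t - c - (s - c) = t - s by ring.
  case: ltP => // ts; have -> : s = t by apply/eqP; rewrite eq_le st ts.
  by rewrite addrN.
Qed.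

Lemma integral_scale (c : R) (g : R -> R) : 0 < c ->
  measurable_fun [set: R] g ->
  (\int[mu]_x (g x)%:E = \int[mu]_x (g (c * x) * c)%:E)%E.
Proof.
move=> c0 mg.
rewrite (@integral_change_of_variable R (fun x => c * x) (fun=> c))//.
- by move=> x y; rewrite /= ler_pM2l.
- by move=> y; exists (c^-1 * y); rewrite mulVKf// gt_eqF.
- by move=> _; exact: ltW.
- move=> s t st; rewrite integral_cst//= lebesgue_measure_itv/= lte_fin -mulrBr.
  case: ltP => // ts; have -> : s = t by apply/eqP; rewrite eq_le st ts.
  by rewrite addrN mulr0 mule0.
Qed.

(** The cut at 0 replaces the default values of [powR] off the positive axis; thanks to it a
    convolution of two kernels over the line only sees 0 < y < x. *)
Definition kern (al x : R) : R := if 0 < x then x `^ (al - 1) else 0.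

Lemma kern_ge0 al x : 0 <= kern al x.
Proof. by rewrite /kern; case: ifP => // _; exact: powR_ge0. Qed.

Lemma kern0 (al x : R) : x <= 0 -> kern al x = 0.
Proof. by rewrite /kern ltNge => ->. Qed.

Lemma kern_gt0E (al x : R) : 0 < x -> kern al x = x `^ (al - 1).
Proof. by rewrite /kern => ->. Qed.

Lemma measurable_kern al : measurable_fun [set: R] (kern al).
Proof.
rewrite (_ : kern al = (fun x => x `^ (al - 1)) \* \1_(`]0, +oo[%classic)).
  by apply: measurable_funM; [exact: measurable_powR|exact: measurable_indic].
apply/funext => x /=; rewrite indicE /kern mem_setE in_itv/= andbT.
by case: ifP => _; rewrite ?mulr1 ?mulr0.
Qed.

Lemma kernM (al c x : R) : 0 < c -> kern al (c * x) = c `^ (al - 1) * kern al x.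
Proof.
move=> c0; rewrite /kern pmulr_rgt0//; case: ifPn => x0; last by rewrite mulr0.
by rewrite powRM// ltW.
Qed.

Lemma kern_continuous (al x : R) : 0 < x -> {for x, continuous (kern al)}.
Proof.
move=> x0.
have cp : {for x, continuous (fun x : R => x `^ (al - 1))}.
  apply: differentiable_continuous; apply/derivable1_diffP.
  by apply: derivable_powR; rewrite in_itv/= x0.
rewrite /prop_for /continuous_at (kern_gt0E al x0).
apply: cvg_trans cp; apply: near_eq_cvg.
near=> y; rewrite kern_gt0E//.
by near: y; exact: lt_nbhsr.
Unshelve. all: by end_near. Qed.

(** For al < 1 the integrand is unbounded at 0, so the primitive x^al / al is used on [1/(n+1), 1]
    and these intervals exhaust ]0, 1]. *)
Lemma integral_kern01 (al : R) : 0 < al ->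
  (\int[mu]_(x in `]0%R, 1%R]) (kern al x)%:E <= (al^-1)%:E)%E.
Proof.
move=> al0.
have H n : (\int[mu]_(x in `[n.+1%:R^-1%R, 1%R]) (kern al x)%:E <= (al^-1)%:E)%E.
  case: n => [|n].
    by rewrite invr1 set_itv1 integral_set1 lee_fin invr_ge0 ltW.
  have e0 : 0 < n.+2%:R^-1 :> R by rewrite invr_gt0.
  have e1 : n.+2%:R^-1 < 1 :> R by rewrite invf_lt1// ltr1n.
  have pos (x : R) : x \in `[n.+2%:R^-1, 1] -> 0 < x.
    by rewrite in_itv/= => /andP[+ _]; exact: lt_le_trans.
  have dF (x : R) : 0 < x -> is_derive x 1 (fun x => al^-1 * x `^ al) (kern al x).
    move=> x0.
    have dx : derivable (fun x : R => x `^ al) x 1 by apply: derivable_powR; rewrite in_itv/= x0.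
    rewrite (kern_gt0E al x0).
    have -> : x `^ (al - 1) = al^-1 *: derive1 (fun x : R => x `^ al) x.
      by rewrite powR_derive1 ?in_itv/= ?x0// /GRing.scale/= mulKf// gt_eqF.
    rewrite derive1E; apply: (@is_deriveZ _ _ _ (fun x : R => x `^ al)).
    exact: DeriveDef.
  have cF (x : R) : 0 < x -> {for x, continuous (fun x => al^-1 * x `^ al)}.
    move=> /dF dx; apply: differentiable_continuous.
    by apply/derivable1_diffP; exact: ex_derive.
  rewrite (@continuous_FTC2 _ _ (fun x => al^-1 * x `^ al))//.
  - rewrite powR1 mulr1 -EFinB lee_fin lerBlDr lerDl mulr_ge0 ?powR_ge0//.
    by rewrite invr_ge0 ltW.
  - apply: continuous_in_subspaceT => x; rewrite inE => /pos x0.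
    exact: kern_continuous.
  - split.
    + by move=> x /subset_itv_oo_cc/pos/dF dx; exact: ex_derive.
    + by apply: cvg_at_right_filter; exact: cF.
    + by apply: cvg_at_left_filter; exact: cF.
  - by move=> x /subset_itv_oo_cc/pos/dF dx; rewrite derive1E; exact: derive_val.
have -> : `]0%R, 1%R]%classic = \bigcup_n `[n.+1%:R^-1%R, 1%R]%classic :> set R.
  apply/seteqP; split => x /=.
    rewrite in_itv/= => /andP[x0 x1].
    have [n _ /(_ n (leqnn _))/= nx] := near_infty_natSinv_lt (PosNum x0).
    by exists n => //=; rewrite in_itv/= x1 ltW.
  move=> [n _] /=; rewrite !in_itv/= => /andP[nx ->]; rewrite andbT.
  by rewrite (lt_le_trans _ nx)// invr_gt0.
have mk D : measurable_fun D (fun x : R => (kern al x)%:E).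
  by apply/measurable_EFinP; apply: measurable_funTS; exact: measurable_kern.
have cv : (\int[mu]_(x in `[i.+1%:R^-1%R, 1%R]) (kern al x)%:E @[i --> \oo] -->
    \int[mu]_(x in \bigcup_n `[n.+1%:R^-1%R, 1%R]%classic) (kern al x)%:E)%E.
  apply: ge0_nondecreasing_set_cvg_integral => //.
  - move=> n m nm; apply/subsetPset => x /=; rewrite !in_itv/= => /andP[+ ->].
    rewrite andbT; apply: le_trans.
    by rewrite lef_pV2 ?posrE ?ltr0n// ler_nat.
  - by move=> i; exact: mk.
  - by move=> i x _; rewrite lee_fin kern_ge0.
rewrite -(cvg_lim _ cv)//; apply: lime_le; first by apply/cvg_ex; eexists; exact: cv.
by apply: nearW => n; exact: H.
Unshelve. all: by end_near. Qed.

(** Extended-real valued: [Gamma] goes through [fine], which would hide an infinite integral as 0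
    until finiteness is proved. *)
Definition egamma (al : R) : \bar R := (\int[mu]_x (kern al x * expR (- x))%:E)%E.

Lemma measurable_kern_exp al :
  measurable_fun [set: R] (fun x => kern al x * expR (- x)).
Proof.
apply: measurable_funM; first exact: measurable_kern.
by apply: measurableT_comp => //; exact: measurableT_comp.
Qed.

Lemma GammaE (al : R) : Gamma al = fine (egamma al).
Proof.
rewrite /Gamma Rintegral_mkcond; congr fine; apply: eq_integral => x _.
rewrite patchE mem_setE in_itv/= andbT /kern.
by case: ifP; rewrite ?mul0r.
Qed.

Lemma integral_expN_half : (\int[mu]_(x in `[0%R, +oo[) (expR (- (x / 2)))%:E = 2%:E)%E.
Proof.
have := @integral_exponential_pdf R 2^-1; rewrite invr_gt0 ltr0n => /(_ isT).
have -> : (\int[mu]_x (exponential_pdf 2^-1 x)%:E =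
    \int[mu]_(x in `[0%R, +oo[) (2^-1%:E * (expR (- (x / 2)))%:E))%E.
  rewrite [RHS]integral_mkcond; apply: eq_integral => x _.
  rewrite /exponential_pdf !patchE; case: ifP => // _.
  by rewrite EFinM mulNr (mulrC _ x).
rewrite ge0_integralZl//; last first.
  apply/measurable_EFinP; apply: measurable_funTS.
  by apply: measurableT_comp => //; apply: measurableT_comp => //; exact: measurable_funM.
move=> /(congr1 (fun z => 2%:E * z)%E).
by rewrite muleA -EFinM divff// mul1e mule1.
Qed.

Lemma kern_exp_le (al : R) : 0 < al -> exists2 C : R, 0 <= C & forall x, 1 <= x ->
  kern al x * expR (- x) <= C * expR (- (x / 2)).
Proof.
(* With this [K], applying ln y < y at y = x / K gives al * ln x <= x / 2 + al * [|ln K|], so the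
   power costs half of the exponential. *)
move=> al0; pose K := 2 * al; have K0 : 0 < K by rewrite mulr_gt0.
exists (expR (al * `|ln K|)); first exact: expR_ge0.
move=> x x1; have x0 : 0 < x by rewrite (lt_le_trans _ x1).
rewrite kern_gt0E// /powR gt_eqF// -!expRD ler_expR.
have lx : 0 <= ln x by exact: ln_ge0.
have : ln x <= x / K + `|ln K|.
  have := @ln_sublinear _ (x / K) (divr_gt0 x0 K0).
  rewrite ln_div ?posrE// => /ltW; rewrite lerBlDr => /le_trans; apply.
  by rewrite lerD2l ler_norm.
move=> /(ler_wpM2l (ltW al0)); rewrite mulrDr.
have -> : al * (x / K) = x / 2.
  by rewrite /K; field; rewrite gt_eqF.
have : (al - 1) * ln x <= al * ln x by rewrite ler_wpM2r// gerBl.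
set a := (al - 1) * ln x; set b := al * ln x; set c := al * `|ln K|.
by move=> *; lra.
Qed.

(** On ]0, 1] the exponential is at most 1; beyond 1 half of it absorbs the power. *)
Lemma egamma_lty (al : R) : 0 < al -> (egamma al < +oo)%E.
Proof.
move=> al0; have [C C0 HC] := kern_exp_le al0.
have mke D : measurable_fun D (fun x : R => (kern al x * expR (- x))%:E).
  apply/measurable_EFinP; apply: measurable_funTS; exact: measurable_kern_exp.
have ke0 x : (0 <= (kern al x * expR (- x))%:E)%E.
  by rewrite lee_fin mulr_ge0 ?expR_ge0 ?kern_ge0.
have -> : egamma al = (\int[mu]_(x in `]0%R, 1%R] `|` `]1%R, +oo[) (kern al x * expR (- x))%:E)%E.
  rewrite [RHS]integral_mkcond; apply: eq_integral => x _; rewrite patchE.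
  case: ifPn => // /negP; rewrite inE/= !in_itv/= andbT => H.
  rewrite kern0 ?mul0r// leNgt; apply/negP => x0; apply: H; rewrite x0/=.
  by case: (leP x 1); [left|right].
rewrite ge0_integral_setU//; last first.
  apply/disj_setPS => x [] /=; rewrite !in_itv/= => /andP[_ x1] /andP[x1' _].
  by move: (lt_le_trans x1' x1); rewrite ltxx.
  exact: mke.
rewrite lte_add_pinfty//.
- apply: (@le_lt_trans _ _ (\int[mu]_(x in `]0%R, 1%R]) (kern al x)%:E)%E).
    apply: ge0_le_integral => //.
    + exact: mke.
    + by apply/measurable_EFinP; apply: measurable_funTS; exact: measurable_kern.
    + move=> x /=; rewrite in_itv/= => /andP[x0 _].
      by rewrite lee_fin ler_piMr ?kern_ge0// -expR0 ler_expR oppr_le0 ltW.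
  by apply: le_lt_trans (integral_kern01 al0) _; rewrite ltry.
- have me D : measurable_fun D (fun x : R => (expR (- (x / 2)))%:E).
    apply/measurable_EFinP; apply: measurable_funTS.
    by apply: measurableT_comp => //; apply: measurableT_comp => //; exact: measurable_funM.
  apply: (@le_lt_trans _ _ (\int[mu]_(x in `[0%R, +oo[) (C%:E * (expR (- (x / 2)))%:E))%E).
    apply: (@le_trans _ _ (\int[mu]_(x in `]1%R, +oo[) (C%:E * (expR (- (x / 2)))%:E))%E).
      apply: ge0_le_integral => //.
      + exact: mke.
      + by apply: measurable_funeM; exact: me.
      + move=> x /=; rewrite in_itv/= andbT => /ltW/HC; by rewrite -EFinM lee_fin.
    apply: ge0_subset_integral => //.
    + by apply: measurable_funeM; exact: me.
    + by move=> x _; rewrite mule_ge0 ?lee_fin ?expR_ge0.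
    + by move=> x /=; rewrite !in_itv/= !andbT => /ltW; apply: le_trans.
  rewrite ge0_integralZl//; first by rewrite integral_expN_half -EFinM ltry.
  exact: me.
Qed.

(** Only the part of the integral over [A, A + 1] is kept. The minimum covers both directions of
    monotonicity of x^(al-1). *)
Lemma egamma_ge (al A : R) : 0 < A ->
  ((Num.min (A `^ (al - 1)) ((A + 1) `^ (al - 1)) * expR (- (A + 1)))%:E <= egamma al)%E.
Proof.
move=> A0; set c := _ * _.
have c0 : 0 <= c by rewrite mulr_ge0 ?expR_ge0// le_min !powR_ge0.
apply: (@le_trans _ _ (\int[mu]_(x in `[A, (A + 1)%R]) c%:E)%E).
  rewrite integral_cst//= lebesgue_measure_itv/= lte_fin ltrDl ltr01.
  by rewrite -EFinD [(A + 1)%R]addrC addrK mule1.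
rewrite /egamma.
apply: (@le_trans _ _ (\int[mu]_(x in `[A, (A + 1)%R]) (kern al x * expR (- x))%:E)%E).
  apply: ge0_le_integral => //.
  - apply/measurable_EFinP; apply: measurable_funTS; exact: measurable_kern_exp.
  - move=> x /=; rewrite in_itv/= => /andP[Ax xA]; rewrite lee_fin.
    have x0 : 0 < x by rewrite (lt_le_trans A0).
    apply: ler_pM; rewrite ?expR_ge0//; last by rewrite ler_expR lerN2.
      by rewrite le_min !powR_ge0.
    rewrite kern_gt0E// ge_min; apply/orP; case: (leP 1 al) => al1.
      by left; apply: ge0_ler_powR; rewrite ?nnegrE ?subr_ge0// ltW.
    have E (z : R) : z `^ (al - 1) = (z `^ (1 - al))^-1 by rewrite -powRN opprB.
    right; rewrite !E lef_pV2 ?posrE ?powR_gt0 ?addr_gt0//.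
    by apply: ge0_ler_powR; rewrite ?nnegrE ?subr_ge0 ?addr_ge0// ltW.
apply: ge0_subset_integral => //.
  apply/measurable_EFinP; exact: measurable_kern_exp.
by move=> x _; rewrite lee_fin mulr_ge0 ?expR_ge0 ?kern_ge0.
Qed.

Lemma egammaE (al : R) : 0 < al -> egamma al = (Gamma al)%:E.
Proof.
move=> al0; rewrite GammaE fineK// ge0_fin_numE ?egamma_lty//.
by apply: integral_ge0 => x _; rewrite lee_fin mulr_ge0 ?expR_ge0 ?kern_ge0.
Qed.

Lemma Gamma_gt0 (al : R) : 0 < al -> 0 < Gamma al.
Proof.
move=> al0; have := @egamma_ge al 1 ltr01; rewrite egammaE// lee_fin; apply: lt_le_trans.
by rewrite mulr_gt0 ?expR_gt0// lt_min !powR_gt0// addr_gt0.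
Qed.

(** As A is arbitrary, Gamma outgrows every exponential, which is what the convergence of the
    Mittag-Leffler series rests on. *)
Lemma Gamma_ge (al A : R) : 1 <= al -> 0 < A ->
  A `^ (al - 1) * expR (- (A + 1)) <= Gamma al.
Proof.
move=> al1 A0; have al0 : 0 < al by rewrite (lt_le_trans _ al1).
have := @egamma_ge al A A0; rewrite egammaE// lee_fin min_l//.
by apply: ge0_ler_powR; rewrite ?nnegrE ?subr_ge0// ?addr_ge0 ?ltW// ltrDl.
Qed.

Lemma Gamma1 : Gamma 1 = 1 :> R.
Proof.
have H := @integral_exponential_pdf R 1 ltr01.
rewrite /Gamma /Rintegral integral_itv_obnd_cbnd; last first.
  apply/measurable_EFinP; apply: measurable_funTS; apply: measurable_funM.
    exact: measurable_powR.
  by apply: measurableT_comp => //; exact: measurableT_comp.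
rewrite -[RHS]/(fine 1%E) -H integral_mkcond; congr fine.
apply: eq_integral => x _; rewrite /exponential_pdf !patchE; case: ifP => // _.
by rewrite subrr powRr0 !mul1r mulN1r.
Qed.

End gamma.

(** * Riemann-Liouville integrals on the line *)
Section riemann_liouville.
Context {R : realType}.
Notation mu := (@lebesgue_measure R).

Lemma powRDgt0 (x a b : R) : 0 < x -> x `^ a * x `^ b = x `^ (a + b).
Proof. by move=> x0; rewrite -powRD// (gt_eqF x0) implybT. Qed.

Lemma measurable_conv (f g : R -> R) : measurable_fun [set: R] f ->
  measurable_fun [set: R] g ->
  measurable_fun [set: R * R] (fun z => f (z.1 - z.2) * g z.2).
Proof.
move=> mf mg; apply: measurable_funM.
  by apply: (measurableT_comp mf); exact: measurable_funB.
exact: (measurableT_comp mg).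
Qed.

Lemma measurable_sub_comp (x : R) (f : R -> R) : measurable_fun [set: R] f ->
  measurable_fun [set: R] (fun y => f (x - y)).
Proof. by move=> mf; apply: (measurableT_comp mf); exact: measurable_funB. Qed.

(** The Beta integral B(al, be): the two kernels confine u to ]0, 1[. *)
Definition kern_conv1 (al be : R) : \bar R :=
  (\int[mu]_u (kern al (1 - u) * kern be u)%:E)%E.

Lemma kern_conv1_ge0 al be : (0 <= kern_conv1 al be)%E.
Proof. by apply: integral_ge0 => x _; rewrite lee_fin mulr_ge0 ?kern_ge0. Qed.

Lemma measurable_kern_kern (al be x : R) :
  measurable_fun [set: R] (fun y => kern al (x - y) * kern be y).
Proof.
apply: measurable_funM; last exact: measurable_kern.
apply: measurable_sub_comp; exact: measurable_kern.
Qed.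

(** Homogeneity: the substitution y = x u extracts the power of x and leaves the Beta integral. *)
Lemma kern_conv (al be x : R) :
  (\int[mu]_y (kern al (x - y) * kern be y)%:E =
   (kern (al + be) x)%:E * kern_conv1 al be)%E.
Proof.
case: (leP x 0) => x0.
  rewrite [in RHS]kern0// mul0e; apply: integral0_eq => y _.
  case: (leP y 0) => y0; first by rewrite (kern0 be y0) mulr0.
  by rewrite kern0 ?mul0r// subr_le0 (le_trans x0)// ltW.
rewrite (integral_scale x0); last exact: measurable_kern_kern.
rewrite -ge0_integralZl//; last 3 first.
- by apply/measurable_EFinP; exact: measurable_kern_kern.
- by move=> y _; rewrite lee_fin mulr_ge0 ?kern_ge0.
- by rewrite lee_fin kern_ge0.
apply: eq_integral => y _; rewrite -EFinM; congr EFin.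
have -> : x - x * y = x * (1 - y) by ring.
rewrite !kernM// (kern_gt0E _ x0).
have -> : x `^ (al + be - 1) = x `^ (al - 1) * x `^ (be - 1) * x.
  rewrite -{4}(powRr1 (ltW x0)) !powRDgt0//; congr (_ `^ _); ring.
ring.
Qed.

(** After the shift of x by y in one of the Gamma integrals, the exponentials merge into e^(-x), and
    Tonelli leaves a convolution of kernels inside. *)
Lemma egammaM (al be : R) : 0 < al -> 0 < be ->
  (egamma al * egamma be = kern_conv1 al be * egamma (al + be))%E.
Proof.
move=> al0 be0.
have mK a : measurable_fun [set: R] (fun x : R => (kern a x * expR (- x))%:E).
  by apply/measurable_EFinP; exact: measurable_kern_exp.
have K0 a (x : R) : (0 <= (kern a x * expR (- x))%:E)%E.
  by rewrite lee_fin mulr_ge0 ?expR_ge0 ?kern_ge0.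
have G0 (a : R) : (0 <= egamma a)%E.
  by apply: integral_ge0 => x _; rewrite lee_fin mulr_ge0 ?expR_ge0 ?kern_ge0.
rewrite muleC {1}/egamma -ge0_integralZr//; last exact: mK.
pose F (z : R * R) : \bar R := ((kern al (z.2 - z.1) * kern be z.1) * expR (- z.2))%:E.
have mF : measurable_fun [set: R * R] F.
  apply/measurable_EFinP; apply: measurable_funM.
    apply: measurable_funM.
      apply: (measurableT_comp (@measurable_kern _ al)).
      exact: measurable_funB.
    exact: (measurableT_comp (@measurable_kern _ be)).
  by apply: measurableT_comp => //; exact: measurableT_comp.
have F0 z : (0 <= F z)%E.
  by rewrite lee_fin mulr_ge0 ?expR_ge0// mulr_ge0 ?kern_ge0.
transitivity (\int[mu]_y \int[mu]_x F (y, x))%E.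
  apply: eq_integral => y _.
  rewrite /egamma (@ge0_integral_shift _ y)//.
  rewrite -ge0_integralZl//.
  - apply: eq_integral => x _; rewrite /F -EFinM /=; congr EFin.
    rewrite opprB expRD.
    transitivity (expR (- y) * expR y * (kern al (x - y) * kern be y * expR (- x))).
      ring.
    by rewrite -expRD addNr expR0 mul1r.
  - apply: (measurableT_comp (mK al)).
    exact: measurable_funB.
rewrite fubini_tonelli//.
rewrite muleC -ge0_integralZr//; last exact: kern_conv1_ge0.
apply: eq_integral => x _.
transitivity (\int[mu]_y ((kern al (x - y) * kern be y)%:E * (expR (- x))%:E))%E.
  by apply: eq_integral => y _; rewrite /F/= EFinM.
rewrite ge0_integralZr//; last 2 first.
- by apply/measurable_EFinP; exact: measurable_kern_kern.
- by move=> y _; rewrite lee_fin mulr_ge0 ?kern_ge0.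
  by rewrite kern_conv EFinM muleAC.
exact: mK.
Qed.

Lemma kern_conv1E (al be : R) : 0 < al -> 0 < be ->
  kern_conv1 al be = (Gamma al * Gamma be / Gamma (al + be))%:E.
Proof.
move=> al0 be0; have ab0 : 0 < al + be by rewrite addr_gt0.
have := egammaM al0 be0; rewrite !egammaE//.
have g0 := Gamma_gt0 ab0; have := kern_conv1_ge0 al be.
case: (kern_conv1 al be) => [r _| _ |//].
  by rewrite -!EFinM => -[->]; rewrite mulfK// gt_eqF.
by rewrite gt0_mulye ?lte_fin.
Qed.

(** Used both as the kernel of the fractional integral and as the normalized power in which bounds
    are expressed. The factor 1 / Gamma makes the orders simply add up under convolution. *)
Definition rlk (al x : R) : R := kern al x / Gamma al.

Lemma rlk_ge0 (al x : R) : 0 < al -> 0 <= rlk al x.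
Proof. by move=> al0; rewrite divr_ge0 ?kern_ge0// ltW// Gamma_gt0. Qed.

Lemma rlk0 (al x : R) : x <= 0 -> rlk al x = 0.
Proof. by move=> x0; rewrite /rlk kern0// mul0r. Qed.

Lemma rlk_gt0E (al x : R) : 0 < x -> rlk al x = x `^ (al - 1) / Gamma al.
Proof. by move=> x0; rewrite /rlk kern_gt0E. Qed.

Lemma rlk_gt0 (al x : R) : 0 < al -> 0 < x -> 0 < rlk al x.
Proof. by move=> al0 x0; rewrite rlk_gt0E// divr_gt0 ?powR_gt0 ?Gamma_gt0. Qed.

Lemma rlk1 (x : R) : 0 < x -> rlk 1 x = 1.
Proof. by move=> x0; rewrite rlk_gt0E// subrr powRr0 Gamma1 divr1. Qed.

Lemma measurable_rlk (al : R) : measurable_fun [set: R] (rlk al).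
Proof. by apply: measurable_funM => //; exact: measurable_kern. Qed.

Lemma rlk_conv (al be x y : R) : 0 < al -> 0 < be ->
  (\int[mu]_t (rlk al (x - t) * rlk be (t - y))%:E = (rlk (al + be) (x - y))%:E)%E.
Proof.
move=> al0 be0.
have mk : measurable_fun [set: R] (fun t => kern al (x - y - t) * kern be t).
  exact: measurable_kern_kern.
have mky : measurable_fun [set: R] (fun t => kern al (x - y - (t - y)) * kern be (t - y)).
  by apply: (measurableT_comp mk); exact: measurable_funB.
transitivity (\int[mu]_t (((Gamma al * Gamma be)^-1)%:E *
    (kern al (x - y - (t - y)) * kern be (t - y))%:E))%E.
  apply: eq_integral => t _; rewrite -EFinM /rlk; congr EFin.
  have -> : x - y - (t - y) = x - t by ring.
  by rewrite invfM mulrACA [in RHS]mulrC.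
rewrite ge0_integralZl//; last 3 first.
- exact/measurable_EFinP.
- by move=> t _; rewrite lee_fin mulr_ge0 ?kern_ge0.
- by rewrite lee_fin invr_ge0 mulr_ge0// ltW// Gamma_gt0.
rewrite -(@ge0_integral_shift _ y (fun t => (kern al (x - y - t) * kern be t)%:E))//; last 2 first.
- exact/measurable_EFinP.
- by move=> t; rewrite lee_fin mulr_ge0 ?kern_ge0.
rewrite kern_conv kern_conv1E// -!EFinM /rlk; congr EFin.
have aux (a b c k : R) : a != 0 -> b != 0 -> (a * b)^-1 * (k * (a * b / c)) = k / c.
  by move=> a0 b0; rewrite mulrCA mulKf// mulf_neq0.
by rewrite aux// gt_eqF// Gamma_gt0.
Qed.

Lemma integrable_rlk_conv (al be x y : R) : 0 < al -> 0 < be ->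
  mu.-integrable [set: R] (EFin \o (fun t => rlk al (x - t) * rlk be (t - y))).
Proof.
move=> al0 be0; apply/integrableP; split.
  apply/measurable_EFinP; apply: measurable_funM.
    by apply: measurable_sub_comp; exact: measurable_rlk.
  by apply: (measurableT_comp (@measurable_rlk be)); exact: measurable_funB.
apply: (@le_lt_trans _ _ (rlk (al + be) (x - y))%:E); last exact: ltry.
rewrite -rlk_conv// le_eqVlt; apply/orP; left; apply/eqP.
apply: eq_integral => t _ /=; congr EFin; rewrite ger0_norm//.
by apply: mulr_ge0; exact: rlk_ge0.
Qed.

(** When [g] is not integrable and c != 0, both integrals are infinite and [fine] turns them into
    0. *)
Lemma RintegralZl_ge0 (c : R) (g : R -> R) : measurable_fun [set: R] g ->
  \int[mu]_x (c * g x) = c * \int[mu]_x g x.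
Proof.
move=> mg; have [->|c0] := eqVneq c 0.
  rewrite mul0r /Rintegral integral0_eq// => x _; by rewrite mul0r.
have [ig|nig] := pselect (mu.-integrable [set: R] (EFin \o g)).
  exact: RintegralZl.
have fin0 (h : R -> R) : measurable_fun [set: R] h ->
    ~ mu.-integrable [set: R] (EFin \o h) -> \int[mu]_x h x = 0.
  move=> mh nh; rewrite /Rintegral.
  have : ~ ((\int[mu]_x (h x)%:E)%E \is a fin_num).
    rewrite -integral_fin_num_abs// => H; apply: nh; apply/integrableP; split => //.
    exact/measurable_EFinP.
  by case: (\int[mu]_x (h x)%:E)%E.
rewrite !fin0 ?mulr0//; first exact: measurable_funM.
move=> icg; apply: nig.
have := integrableZl measurableT c^-1 icg.
by apply: eq_integrable => // x _; rewrite /= -EFinM mulKf.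
Qed.

Definition RL (al : R) (h : R -> R) (x : R) : R := \int[mu]_y (rlk al (x - y) * h y).

Definition RL_integrable (al : R) (h : R -> R) (x : R) : Prop :=
  mu.-integrable [set: R] (EFin \o (fun y => rlk al (x - y) * h y)).

Lemma measurable_rlk_mul (al x : R) h : measurable_fun [set: R] h ->
  measurable_fun [set: R] (fun y => rlk al (x - y) * h y).
Proof.
by move=> mh; apply: measurable_funM => //; apply: measurable_sub_comp; exact: measurable_rlk.
Qed.

Lemma rlk_mul_local (al x y : R) (h1 h2 : R -> R) : (forall y, y < x -> h1 y = h2 y) ->
  rlk al (x - y) * h1 y = rlk al (x - y) * h2 y.
Proof.
move=> h12; case: (ltP y x) => yx; first by rewrite h12.
by rewrite rlk0 ?mul0r// subr_le0.
Qed.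

Lemma RL_local (al x : R) (h1 h2 : R -> R) : (forall y, y < x -> h1 y = h2 y) ->
  RL al h1 x = RL al h2 x.
Proof. by move=> h12; apply: eq_Rintegral => y _; exact: rlk_mul_local. Qed.

Lemma RL_integrable_local (al x : R) (h1 h2 : R -> R) : (forall y, y < x -> h1 y = h2 y) ->
  RL_integrable al h1 x -> RL_integrable al h2 x.
Proof.
by move=> h12; apply: eq_integrable => // y _; congr EFin; exact: rlk_mul_local.
Qed.

(** Fubini applies because integrating the absolute value in t first gives, by [rlk_conv], the
    integrand of the assumed integral of order al + be. *)
Lemma RL_semigroup (al be x : R) (h : R -> R) : 0 < al -> 0 < be ->
  measurable_fun [set: R] h -> RL_integrable (al + be) h x ->
  RL_integrable al (RL be h) x /\ RL al (RL be h) x = RL (al + be) h x.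
Proof.
move=> al0 be0 mh ih.
pose F (z : R * R) : \bar R := (rlk al (x - z.1) * (rlk be (z.1 - z.2) * h z.2))%:E.
have mF : measurable_fun [set: R * R] F.
  apply/measurable_EFinP; apply: measurable_funM.
    apply: (measurableT_comp (measurable_sub_comp x (@measurable_rlk al))).
    exact: measurable_fst.
  exact: measurable_conv (@measurable_rlk be) mh.
have iF : (mu \x mu)%E.-integrable [set: R * R] F.
  apply/integrable21ltyP => //.
  move/integrableP : ih => [_]; congr (_ < _)%E; apply: eq_integral => y _.
  transitivity (\int[mu]_t ((rlk al (x - t) * rlk be (t - y))%:E * `|h y|%:E))%E.
    rewrite ge0_integralZr//; last 2 first.
    - apply/measurable_EFinP; apply: measurable_funM.
        by apply: measurable_sub_comp; exact: measurable_rlk.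
      by apply: (measurableT_comp (@measurable_rlk be)); exact: measurable_funB.
    - by move=> t _; rewrite lee_fin mulr_ge0 ?rlk_ge0.
    by rewrite rlk_conv//= normrM ger0_norm ?EFinM// rlk_ge0// addr_gt0.
  apply: eq_integral => t _; rewrite -EFinM /F/=; congr EFin.
  rewrite mulrA [RHS]normrM; congr (_ * _); rewrite ger0_norm//.
  by apply: mulr_ge0; exact: rlk_ge0.
have cF t : fine (\int[mu]_y F (t, y))%E = rlk al (x - t) * RL be h t.
  by rewrite -RintegralZl_ge0//; exact: measurable_rlk_mul.
have iG := integrable_fubini_F iF.
have eG : EFin \o (fun t => rlk al (x - t) * RL be h t) = EFin \o (fine \o (fubini_F mu F)).
  by apply/funext => t /=; rewrite -cF.
split.
  rewrite /RL_integrable eG; apply: le_integrable iG => //.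
    apply: measurableT_comp => //; apply: measurableT_comp => //.
    exact: measurable_fubini_F iF.
  have aux (z : \bar R) : (`|(fine z)%:E| <= `|z|)%E.
    by case: z => [r||] /=; rewrite ?leey.
  by move=> t _; exact: aux.
transitivity (fine (\int[mu]_t fubini_F mu F t)%E).
  rewrite /RL /Rintegral; congr fine.
  under eq_integral => t _ do rewrite -/((EFin \o (fun t => rlk al (x - t) * RL be h t)) t) eG.
  (* The inner integral may be infinite for t in a null set, where [RL be h t] takes the default
     value 0. *)
  apply: ae_eq_integral => //.
  - apply: measurableT_comp => //; apply: measurableT_comp => //.
    exact: measurable_fubini_F iF.
  - exact: measurable_fubini_F iF.
  - have := integrable_ae measurableT iG; apply: filterS => t /(_ I) ft _.
    by rewrite /= fineK.
rewrite /fubini_F Fubini//; congr fine; apply: eq_integral => y _.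
transitivity (\int[mu]_t ((h y)%:E * (rlk al (x - t) * rlk be (t - y))%:E))%E.
  by apply: eq_integral => t _; rewrite /F -EFinM; congr EFin; ring.
rewrite integralZl//; last exact: integrable_rlk_conv.
by rewrite rlk_conv// -EFinM mulrC.
Qed.

(** The kernel vanishes for y >= x, so domination is only asked below x. It serves weighted
    functions, with be = 1 - g, as well as the differences of Picard iterates. *)
Lemma RL_bound (al be x M : R) (h : R -> R) : 0 < al -> 0 < be ->
  measurable_fun [set: R] h -> (forall y, y < x -> `|h y| <= M * rlk be y) ->
  RL_integrable al h x /\ `|RL al h x| <= M * rlk (al + be) x.
Proof.
move=> al0 be0 mh hM.
pose k y := M * (rlk al (x - y) * rlk be (y - 0)).
have ik : mu.-integrable [set: R] (EFin \o k).
  exact: (integrableZl measurableT M (integrable_rlk_conv x 0 al0 be0)).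
have hk y : `|rlk al (x - y) * h y| <= k y.
  rewrite normrM ger0_norm ?rlk_ge0// /k mulrCA subr0.
  case: (ltP y x) => yx; first by rewrite ler_wpM2l ?rlk_ge0// hM.
  by rewrite rlk0 ?mul0r// subr_le0.
have ih : RL_integrable al h x.
  apply: le_integrable ik => //.
    by apply/measurable_EFinP; exact: measurable_rlk_mul.
  by move=> y _; rewrite /= lee_fin (le_trans (hk y))// ler_norm.
split => //; apply: le_trans (le_normr_Rintegral measurableT ih) _.
apply: (@le_trans _ _ (\int[mu]_y k y)).
  by apply: le_Rintegral => //; exact: integrable_norm.
rewrite /k RintegralZl//; last exact: integrable_rlk_conv.
by rewrite /Rintegral rlk_conv// subr0.
Qed.

Lemma RLB (al x : R) (h1 h2 : R -> R) : RL_integrable al h1 x -> RL_integrable al h2 x ->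
  RL_integrable al (fun y => h1 y - h2 y) x /\
  RL al (fun y => h1 y - h2 y) x = RL al h1 x - RL al h2 x.
Proof.
move=> i1 i2; split.
  have := integrableB measurableT i1 i2; apply: eq_integrable => // y _.
  by rewrite /= -EFinB mulrBr.
by rewrite -RintegralB//; apply: eq_Rintegral => y _; rewrite mulrBr.
Qed.

Lemma RLZ (al x c : R) (h : R -> R) : RL_integrable al h x ->
  RL_integrable al (fun y => c * h y) x /\ RL al (fun y => c * h y) x = c * RL al h x.
Proof.
move=> ih; split.
  have := integrableZl measurableT c ih; apply: eq_integrable => // y _.
  by rewrite /= -EFinM mulrCA.
by rewrite -RintegralZl//; apply: eq_Rintegral => y _; rewrite mulrCA.
Qed.

Lemma RL_rlk (al be x : R) : 0 < al -> 0 < be ->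
  RL_integrable al (rlk be) x /\ RL al (rlk be) x = rlk (al + be) x.
Proof.
move=> al0 be0; have i := integrable_rlk_conv x 0 al0 be0; split.
  by apply: eq_integrable i => // y _; rewrite /= subr0.
have := rlk_conv x 0 al0 be0; rewrite subr0 => H.
rewrite -[RHS]/(fine (_%:E)) -H; congr fine; apply: eq_integral => y _.
by rewrite subr0.
Qed.

End riemann_liouville.

(** * Fundamental theorem of calculus for everywhere derivable functions *)
Section derivable_FTC.
Context {R : realType}.
Notation mu := (@lebesgue_measure R).
Implicit Types (H h : R -> R) (c d x y : R).

Lemma is_derive_local_lipschitz H (x dH M : R) : is_derive x 1 H dH -> `|dH| < M ->
  exists2 r : R, 0 < r & forall y, `|y - x| < r -> `|H y - H x| <= M * `|y - x|.
Proof.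
move=> dHx dM.
have : (fun h : R => h^-1 *: (H (h *: 1 + x) - H x)) @ 0^' --> dH.
  rewrite -[X in _ --> X](@derive_val _ _ _ _ _ _ _ dHx).
  exact: (@ex_derive _ _ _ _ _ _ _ dHx).
move=> /cvgrPdist_lt/(_ (M - `|dH|)); rewrite subr_gt0 => /(_ dM)[r /= r0 Hr].
exists r => // y yr; have [->|yx] := eqVneq y x.
  by rewrite !subrr normr0 mulr0.
have yx0 : y - x != 0 by rewrite subr_eq0.
have /= := Hr (y - x); rewrite sub0r normrN => /(_ yr yx0).
rewrite /GRing.scale/= mulr1 subrK; set q := _ * _ => qM.
have -> : H y - H x = q * (y - x) by rewrite /q mulrAC mulVf// mul1r.
rewrite normrM ler_wpM2r//.
have := ler_normB dH (dH - q); rewrite subKr => /le_trans; apply.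
by rewrite -lerBrDl ltW.
Qed.

(** * Increments of a derivable function against a majorant of its derivative *)

Section covering.
Variables (H h : R -> R) (c d : R).
Hypothesis cd : c <= d.
Hypothesis dH : forall x, c <= x <= d -> is_derive x 1 H (h x).
Hypothesis ih : mu.-integrable `[c, d] (EFin \o h).
Variable eta : R.
Hypothesis eta0 : 0 < eta.

Let E k : set R := `[c, d] `&` [set x | (k%:R * eta <= `|h x|) && (`|h x| < k.+1%:R * eta)].

Let mE k : measurable (E k).
Proof.
have mh : measurable_fun `[c, d] (fun x => `|h x|).
  by apply: measurableT_comp => //; move/integrableP : ih => [/measurable_EFinP].
have -> : E k = `[c, d] `&` (fun x => `|h x|) @^-1` `[k%:R * eta, k.+1%:R * eta[.
  by apply/seteqP; split => x /=; rewrite in_itv.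
exact: mh.
Qed.

Let E_cover x : c <= x <= d -> exists k, E k x.
Proof.
move=> xcd; exists (Num.truncn (`|h x| / eta)); split; first by rewrite /= in_itv.
have h0 : 0 <= `|h x| / eta by rewrite divr_ge0// ltW.
by have := truncn_itv h0; rewrite ler_pdivlMr// ltr_pdivrMr.
Qed.

Let trivE : trivIset [set: nat] E.
Proof.
apply/trivIsetP => i j _ _ ij; apply/seteqP; split => // x.
move=> [[_ /= /andP[i1 i2]] [_ /= /andP[j1 j2]]].
have := le_lt_trans i1 j2; have := le_lt_trans j1 i2.
rewrite !ltr_pM2r// !ltr_nat !ltnS => ji ij'.
by move/negP: ij; apply; rewrite eqn_leq ij' ji.
Qed.

Let bigE : \bigcup_k E k = `[c, d]%classic.
Proof.
apply/seteqP; split => x; first by case=> k _ [].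
by move=> /= ; rewrite in_itv/= => /E_cover[k Ek]; exists k.
Qed.

(** Excess measure allowed around the k-th slice: weighted by the height (k+1) eta it costs eta /
    2^(k+1), for a total of eta. *)
Let dl (k : nat) : R := (2 ^ k.+1)%:R^-1 / k.+1%:R.

Let dl0 k : 0 < dl k.
Proof. by rewrite divr_gt0// ?invr_gt0 ?ltr0n ?expn_gt0. Qed.

Let muE k : (mu (E k) < +oo)%E.
Proof.
apply: (@le_lt_trans _ _ (mu `[c, d]%classic)).
  apply: le_measure; rewrite ?inE; [exact: mE|by []|by move=> x []].
by rewrite lebesgue_measure_itv/=; case: ifPn => // _; rewrite -EFinB ltry.
Qed.

Let exO k : exists O : set R, [/\ open O, E k `<=` O & (mu (O `\` E k) < (dl k)%:E)%E].
Proof. exact: lebesgue_regularity_outer (mE k) (muE k) (dl0 k). Qed.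

Let O k := projT1 (cid (exO k)).
Let oO k : open (O k). Proof. by rewrite /O; case: cid => x []. Qed.
Let EO k : E k `<=` O k. Proof. by rewrite /O; case: cid => x []. Qed.
Let mO k : measurable (O k). Proof. exact: open_measurable. Qed.
Let muO k : (mu (O k) <= mu (E k) + (dl k)%:E)%E.
Proof.
have dO : (mu (O k `\` E k) < (dl k)%:E)%E by rewrite /O; case: cid => x [].
have -> : O k = E k `|` (O k `\` E k) by rewrite setDUK//; exact: EO.
apply: le_trans.
  by apply: measureU2; [exact: mE|apply: measurableD; [exact: mO|exact: mE]].
by rewrite leeD2l// ltW.
Qed.

(** The lower semicontinuous majorant: if x is in [E k], then [u] is at least (k+1) eta, hence above
    [|h x|], on the whole neighbourhood [O k] of x. *)
Let u x : \bar R := (\sum_(k <oo) (k.+1%:R * eta * \1_(O k) x)%:E)%E.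

Let uk0 k x : 0 <= k.+1%:R * eta * \1_(O k) x.
Proof. by rewrite mulr_ge0// mulr_ge0// ltW. Qed.

Let u0 x : (0 <= u x)%E.
Proof. by apply: nneseries_ge0 => k _ _; rewrite lee_fin uk0. Qed.

Let muk k : measurable_fun [set: R] (fun x => (k.+1%:R * eta * \1_(O k) x)%:E).
Proof. by apply/measurable_EFinP; apply: measurable_funM. Qed.

Let mu_u D : measurable_fun D u.
Proof.
apply: measurable_funTS; apply: ge0_emeasurable_sum; last by move=> k _; exact: muk.
by move=> k x _ _; rewrite lee_fin uk0.
Qed.

(** On [E k] the height (k+1) eta is at most [|h| + eta], and the remainders [O k] minus [E k]
    contribute at most eta altogether. *)
Let integral_u : (\int[mu]_(x in `[c, d]) u x <=
  \int[mu]_(x in `[c, d]) (`|h x| + eta)%:E + eta%:E)%E.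
Proof.
have mhe : measurable_fun `[c, d] (fun x => (`|h x| + eta)%:E).
  apply/measurable_EFinP; apply: measurable_funD => //.
  by apply: measurableT_comp => //; move/integrableP : ih => [/measurable_EFinP].
have he0 x : (0 <= (`|h x| + eta)%:E)%E by rewrite lee_fin addr_ge0// ltW.
rewrite /u integral_nneseries//; last 2 first.
- by move=> k; apply: measurable_funTS; exact: muk.
- by move=> k x _; rewrite lee_fin uk0.
rewrite -[in leRHS]bigE ge0_integral_bigcup//; last by rewrite bigE.
apply: le_trans; last first.
  apply: epsilon_trick; first by move=> k; exact: integral_ge0.
  exact: ltW.
apply: lee_nneseries => [k *|k *].
  by apply: integral_ge0 => x _; rewrite lee_fin uk0.
have k0 : 0 <= k.+1%:R * eta by rewrite mulr_ge0// ltW.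
apply: (@le_trans _ _ (\int[mu]_x ((k.+1%:R * eta)%:E * (\1_(O k) x)%:E))%E).
  under eq_integral do rewrite EFinM.
  apply: ge0_subset_integral => //.
  - exact: (muk k).
  - by move=> x _; rewrite mule_ge0 ?lee_fin.
have m1 : measurable_fun [set: R] (fun x => (\1_(O k) x : R)%:E).
  by apply/measurable_EFinP.
rewrite ge0_integralZl; [|by []|exact: m1|by move=> x _; rewrite lee_fin|by rewrite lee_fin].
rewrite integral_indic; [|by []|exact: mO].
rewrite setIT; apply: le_trans (lee_wpmul2l _ (muO k)) _; first by rewrite lee_fin.
rewrite ge0_muleDr ?lee_fin ?(ltW (dl0 k))//.
apply: leeD; last first.
  rewrite -EFinM lee_fin /dl natrX.
  have -> : k.+1%:R * eta * ((2 ^+ k.+1)^-1 / k.+1%:R) =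
      eta / 2 ^+ k.+1 * (k.+1%:R / k.+1%:R) by ring.
  by rewrite divff ?mulr1// pnatr_eq0.
rewrite -integral_cst; last exact: mE.
apply: ge0_le_integral => //.
- exact: mE.
- by apply: (measurable_funS _ _ mhe) => // x [].
- move=> x [_ /= /andP[hx _]]; rewrite lee_fin -[k.+1]addn1 natrD mulrDl mul1r.
  by rewrite lerD2r.
Qed.

Let U x y : \bar R := (\int[mu]_(t in `]x, y]) u t)%E.

Let UD x y z : x <= y -> y <= z -> (U x y + U y z = U x z)%E.
Proof.
move=> xy yz; rewrite /U.
rewrite (_ : `]x, z]%classic = `]x, y] `|` `]y, z]); last first.
  by rewrite -itv_bndbnd_setU// bnd_simp.
rewrite ge0_integral_setU//; first exact: mu_u.
apply/disj_setPS => t [] /=; rewrite !in_itv/= => /andP[_ ty] /andP[yt _].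
by move: (lt_le_trans yt ty); rewrite ltxx.
Qed.

Let U_ge k x y : x <= y -> `]x, y] `<=` O k -> ((k.+1%:R * eta * (y - x))%:E <= U x y)%E.
Proof.
move=> xy xyO.
apply: (@le_trans _ _ (\int[mu]_(t in `]x, y]) (k.+1%:R * eta)%:E)%E).
  rewrite integral_cst//= lebesgue_measure_itv/= lte_fin.
  case: ltP => xy'; first by rewrite -EFinB -EFinM.
  have -> : x = y by apply/eqP; rewrite eq_le xy xy'.
  by rewrite subrr mulr0 mule0.
apply: ge0_le_integral => //.
- by move=> t _; rewrite lee_fin mulr_ge0// ltW.
- exact: mu_u.
- move=> t xyt; have Ot := xyO t xyt; rewrite /u (@nneseriesD1 _ _ k)//; last first.
    by move=> i _; rewrite lee_fin uk0.
  rewrite indicE mem_set// mulr1 leeDl//.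
  by apply: nneseries_ge0 => i _ _; rewrite lee_fin uk0.
Qed.

(** For x in [E k], the strict inequality [|h x|] < (k+1) eta bounds the difference quotients near x
    by (k+1) eta, a value that [u] reaches throughout [O k]. *)
Let local_bound x : c <= x <= d -> exists2 r : R, 0 < r &
  forall y, `|y - x| < r -> (`|H y - H x|%:E <= U (Num.min x y) (Num.max x y))%E.
Proof.
move=> xcd; have [k Ek] := E_cover xcd.
have [r1 r10 Hr1] : exists2 r : R, 0 < r & forall y, `|y - x| < r ->
    `|H y - H x| <= k.+1%:R * eta * `|y - x|.
  by apply: (is_derive_local_lipschitz (dH xcd)); case: Ek => _ /= /andP[].
have [r2 /= r20 Hr2] : nbhs x (O k) by apply: open_nbhs_nbhs; split => //; exact: EO.
exists (Num.min r1 r2); first by rewrite lt_min r10.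
move=> y; rewrite lt_min => /andP[yr1 yr2].
apply: (@le_trans _ _ (k.+1%:R * eta * `|y - x|)%:E); first by rewrite lee_fin Hr1.
case: (leP x y) => xy.
- rewrite ger0_norm ?subr_ge0//; apply: U_ge => // t /=; rewrite in_itv/= => /andP[xt ty].
  apply: Hr2 => /=; rewrite distrC ger0_norm ?subr_ge0 ?(ltW xt)//.
  by apply: le_lt_trans yr2; rewrite ger0_norm ?subr_ge0// lerD2r.
- rewrite ltr0_norm ?subr_lt0// opprB; apply: U_ge (ltW xy) _ => t /=.
  rewrite in_itv/= => /andP[yt tx].
  apply: Hr2 => /=; rewrite ger0_norm ?subr_ge0//.
  by apply: le_lt_trans yr2; rewrite ltr0_norm ?subr_lt0// opprB lerD2l lerN2 ltW.
Qed.

(** Supremum argument: the local bound at s = sup [A], used on the left of s, puts s in [A]; used on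
    the right, it would extend [A] past s if s < d. *)
Let increment_le_U : (`|H d - H c|%:E <= U c d)%E.
Proof.
pose A : set R := [set t | c <= t <= d /\ (`|H t - H c|%:E <= U c t)%E].
have Ac : A c.
  split; first by rewrite lexx.
  by rewrite subrr normr0; apply: integral_ge0 => x _; exact: u0.
have hsA : has_sup A.
  by split; [exists c|exists d => t [/andP[]]].
pose s := sup A.
have scd : c <= s <= d.
  apply/andP; split; first exact: (ub_le_sup hsA.2 Ac).
  by apply: ge_sup; [exists c|move=> t [/andP[]]].
have [r r0 Hr] := local_bound scd.
have step t y : c <= t -> t <= y -> (`|H t - H c|%:E <= U c t)%E ->
    (`|H y - H t|%:E <= U t y)%E -> (`|H y - H c|%:E <= U c y)%E.
  move=> ct ty h1 h2; rewrite -(UD ct ty).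
  apply: le_trans (leeD h1 h2); rewrite -EFinD lee_fin addrC.
  rewrite (_ : - H c + H y = (H t - H c) + (H y - H t)); last by ring.
  exact: ler_normD.
have As : (`|H s - H c|%:E <= U c s)%E.
  have [t [/andP[ct td] At] st] := sup_adherent r0 hsA.
  have ts : t <= s by apply: ub_le_sup => //; [exact: hsA.2|split => //; rewrite ct].
  apply: (step t) => //.
  have := Hr t; rewrite ler0_norm ?subr_le0// opprB ltrBlDr addrC -ltrBlDr => /(_ st).
  by rewrite distrC (min_r ts) (max_l ts).
case: (ltP s d) => sd; last first.
  by move: As; have -> : s = d by apply/eqP; rewrite eq_le sd andbC; case/andP: scd.
exfalso.
pose y := Num.min d (s + r / 2).
have sy : s < y by rewrite lt_min sd ltrDl divr_gt0.
have yd : y <= d by rewrite ge_min lexx.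
have ysr : y - s < r.
  rewrite ltrBlDl; apply: (@le_lt_trans _ _ (s + r / 2)); first by rewrite ge_min lexx orbT.
  by rewrite ltrD2l ltr_pdivrMr// ltr_pMr// ltr1n.
have cs : c <= s by case/andP: scd.
have : A y.
  split; first by rewrite yd andbT (le_trans cs)// ltW.
  apply: (step s) => //; first exact: ltW.
  have := Hr y; rewrite ger0_norm ?subr_ge0 ?(ltW sy)// => /(_ ysr).
  by rewrite min_l ?(ltW sy)// max_r ?(ltW sy).
by move=> /(ub_le_sup hsA.2); rewrite leNgt sy.
Qed.

(** The first eta is the thickness of a slice, the second the total cost of the open sets. *)
Lemma increment_le_integral_eta :
  (`|H d - H c|%:E <= \int[mu]_(x in `[c, d]) (`|h x| + eta)%:E + eta%:E)%E.
Proof.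
apply: le_trans increment_le_U _; apply: le_trans integral_u.
by apply: ge0_subset_integral => //; [exact: mu_u|exact: subset_itv_oc_cc].
Qed.

End covering.

(* Rudin, Real and Complex Analysis, Theorem 7.21, by a gauge argument: the
   increments of [H] are dominated by those of the integral of a lower
   semicontinuous majorant of [|h|]. *)
Lemma increment_le_integral H h c d : c <= d ->
  (forall x, c <= x <= d -> is_derive x 1 H (h x)) ->
  mu.-integrable `[c, d] (EFin \o h) ->
  `|H d - H c| <= \int[mu]_(x in `[c, d]) `|h x|.
Proof.
move=> cd dH ih; apply/ler_addgt0Pr => e e0.
(* Makes the total error eta (d - c) + eta equal to e. *)
pose eta := e / (d - c + 1).
have dc1 : 0 < d - c + 1 by rewrite ltr_wpDl ?subr_ge0.
have eta0 : 0 < eta by rewrite divr_gt0.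
have := increment_le_integral_eta cd dH ih eta0.
have ih' := integrable_norm ih.
have ie : mu.-integrable `[c, d] (EFin \o (fun=> eta)).
  apply: continuous_compact_integrable; first exact: segment_compact.
  by apply: continuous_subspaceT => ?; exact: cvg_cst.
have -> : (\int[mu]_(x in `[c, d]) (`|h x| + eta)%:E =
   (\int[mu]_(x in `[c, d]) `|h x|)%:E + (eta * (d - c))%:E)%E.
  under eq_integral do rewrite EFinD.
  rewrite integralD_EFin//; congr (_ + _)%E.
    by rewrite fineK//; exact: (integrable_fin_num _ ih').
  rewrite integral_cst//= lebesgue_measure_itv/= lte_fin.
  case: ltP => cd'; first by rewrite -EFinB -EFinM.
  have -> : d = c by apply/eqP; rewrite eq_le cd cd'.
  by rewrite subrr mulr0 mule0.
rewrite -!EFinD lee_fin -addrA.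
by have -> : eta * (d - c) + eta = e by rewrite /eta; field; rewrite gt_eqF.
Qed.

(** Continuous functions [g n] approximate [h] in L^1, and their primitives [G] satisfy the theorem.
    Since H - G has derivative h - g n everywhere, [increment_le_integral] bounds the defect by the
    L^1 distance. *)
Theorem derivable_integral_FTC H h c d : c <= d ->
  (forall x, c <= x <= d -> is_derive x 1 H (h x)) ->
  mu.-integrable `[c, d] (EFin \o h) ->
  \int[mu]_(x in `[c, d]) h x = H d - H c.
Proof.
move=> cd dH ih.
have mcd : (mu `[c, d]%classic < +oo)%E.
  by rewrite lebesgue_measure_itv/=; case: ifPn => // _; rewrite -EFinB ltry.
have [g [cg ig gh]] := approximation_continuous_integrable (measurable_itv `[c, d]) mcd ih.
have mI : measurable (`[c, d]%classic : set (measurableTypeR R)).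
  exact: measurable_itv.
have ihg n : mu.-integrable `[c, d] (EFin \o (fun x => h x - g n x)).
  by have := integrableB mI ih (ig n); apply: eq_integrable.
have gE n : `|H d - H c - \int[mu]_(x in `[c, d]) g n x| <=
    \int[mu]_(x in `[c, d]) `|h x - g n x|.
  (* Starting at c - 1, and working up to d + 1, makes [G] derivable from both sides at c and d
     too. *)
  pose G y := \int[mu]_(t in `[c - 1, y]) g n t.
  have ign : mu.-integrable `[c - 1, d + 1] (EFin \o g n).
    apply: continuous_compact_integrable; first exact: segment_compact.
    exact: continuous_subspaceT.
  have dG x : c <= x <= d -> is_derive x 1 G (g n x).
    move=> /andP[cx xd].
    have [||||G1 G2] := @continuous_FTC1_closed R (g n) (c - 1) x (d + 1).
    - by rewrite ltr_pwDr.
    - exact: ign.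
    - by rewrite ltrBlDr ltr_pwDr.
    - exact: cg.
    by apply: DeriveDef; [exact: G1|rewrite -derive1E; exact: G2].
  have -> : \int[mu]_(x in `[c, d]) g n x = G d - G c.
    rewrite /G Rintegral_itvB; last 3 first.
    - apply: integrableS ign => //; apply: subset_itvl; rewrite bnd_simp lerDl//.
    - by rewrite bnd_simp gerBl.
    - by rewrite bnd_simp.
    rewrite Rintegral_itv_obnd_cbnd//.
    by apply: integrableS (ig n) => //; exact: subset_itv_oc_cc.
  have -> : H d - H c - (G d - G c) = (H d - G d) - (H c - G c) by ring.
  apply: (@increment_le_integral (fun x => H x - G x) (fun x => h x - g n x)) => // x xcd.
  by apply: is_deriveB; [exact: dH|exact: dG].
have hE n : `|\int[mu]_(x in `[c, d]) h x - \int[mu]_(x in `[c, d]) g n x| <=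
    \int[mu]_(x in `[c, d]) `|h x - g n x|.
  by rewrite -RintegralB//; exact: le_normr_Rintegral.
have gh0 : (fun n => \int[mu]_(x in `[c, d]) `|h x - g n x|) @ \oo --> (0 : R).
  have : fine (\int[mu]_(z in `[c, d]) `|(h z - g n z)%:E|)%E @[n --> \oo] --> (0 : R).
    exact: (fine_cvg gh).
  by [].
apply/eqP; rewrite -subr_eq0 -normr_le0; apply/ler_addgt0Pr => e e0; rewrite add0r.
have e20 : 0 < e / 2 by rewrite divr_gt0.
move/cvgrPdist_lt : gh0 => /(_ _ e20)[N _ /(_ N (leqnn N))/=].
rewrite sub0r normrN => HN.
have {}HN := le_lt_trans (ler_norm _) HN.
have -> : \int[mu]_(x in `[c, d]) h x - (H d - H c) =
   (\int[mu]_(x in `[c, d]) h x - \int[mu]_(x in `[c, d]) g N x) -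
   (H d - H c - \int[mu]_(x in `[c, d]) g N x) by ring.
apply: le_trans (ler_normB _ _) _; rewrite [leRHS]splitr.
by apply: lerD; [apply: le_trans (hE N) _|apply: le_trans (gE N) _]; exact: ltW.
Qed.

End derivable_FTC.

(** * Weighted spaces of continuous functions *)
Section weighted.
Context {R : realType}.
Notation mu := (@lebesgue_measure R).
Variable X : R.
Hypothesis X0 : 0 < X.

(** Composition with this retraction turns continuity at the points of [0, X] into continuity and
    boundedness on the line. *)
Definition clamp (x : R) : R := Num.max 0 (Num.min x X).

Lemma clamp_itv x : 0 <= clamp x <= X.
Proof. by rewrite /clamp le_max lexx/= ge_max ge_min lexx orbT ltW. Qed.

Lemma clamp_id x : 0 <= x <= X -> clamp x = x.
Proof. by move=> /andP[x0 xX]; rewrite /clamp min_l// max_r. Qed.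

Lemma clamp_continuous : continuous clamp.
Proof.
move=> x.
apply: (@continuous_max _ _ (fun=> 0) (fun x => Num.min x X) x); first exact: cvg_cst.
by apply: (@continuous_min _ _ id (fun=> X) x); [exact: cvg_id|exact: cvg_cst].
Qed.

(* The counterpart on ]0, X] of [wspace] for [Psi = id]; the functions are set to
   0 elsewhere, so that fractional integrals can be taken over the whole line. *)
Definition wcont (g : R) (h : R -> R) : Prop :=
  (forall x, ~~ (0 < x <= X) -> h x = 0) /\
  exists F : R -> R, exists M : R,
    [/\ continuous F, forall x, `|F x| <= M &
        forall x, 0 < x <= X -> F x = x `^ g * h x].

Lemma wcont_local (g : R) (h F : R -> R) : (forall x, ~~ (0 < x <= X) -> h x = 0) ->
  (forall x, 0 <= x <= X -> {for x, continuous F}) ->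
  (forall x, 0 < x <= X -> F x = x `^ g * h x) -> wcont g h.
Proof.
move=> h0 cF hF; split => //; exists (F \o clamp).
have cFc : continuous (F \o clamp).
  move=> x; apply: continuous_comp; first exact: clamp_continuous.
  exact/cF/clamp_itv.
have wF : {within `[0, X], continuous (fun x => `|(F \o clamp) x|)}.
  apply: continuous_subspaceT => x.
  by apply: (continuous_comp (cFc x)); exact: norm_continuous.
have [m _ Hm] := EVT_max (ltW X0) wF.
exists `|(F \o clamp) m|; split => //.
  move=> x; have := Hm (clamp x); rewrite in_itv/= clamp_itv => /(_ isT).
  by rewrite /= (clamp_id (clamp_itv x)).
move=> x /andP[x0 xX]; rewrite /= clamp_id ?(ltW x0)//.
by apply: hF; rewrite x0.
Qed.

Lemma wcont_eq (g x : R) (h F : R -> R) :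
  (forall x, 0 < x <= X -> F x = x `^ g * h x) -> 0 < x <= X ->
  h x = F x * x `^ (- g).
Proof.
move=> hF xX; have x0 : 0 < x by case/andP: xX.
by rewrite hF// mulrAC powRDgt0// addrN powRr0 mul1r.
Qed.

Lemma wcont_measurable (g : R) h : wcont g h -> measurable_fun [set: R] h.
Proof.
move=> [h0 [F [M [cF FM hF]]]].
rewrite (_ : h = (fun x => F x * x `^ (- g) * \1_(`]0, X]%classic) x)).
  apply: measurable_funM; last exact: measurable_indic.
  apply: measurable_funM; last exact: measurable_powR.
  exact: continuous_measurable_fun.
apply/funext => x; rewrite indicE mem_setE in_itv/=.
case: (boolP (0 < x <= X)) => xX; first by rewrite mulr1; exact: wcont_eq.
by rewrite mulr0 h0.
Qed.

Lemma wcont_bound (g : R) h : g < 1 -> wcont g h ->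
  exists2 M : R, 0 <= M & forall x, `|h x| <= M * rlk (1 - g) x.
Proof.
move=> g1 [h0 [F [M [cF FM hF]]]].
have M0 : 0 <= M by rewrite (le_trans _ (FM 0)).
have g10 : 0 < 1 - g by rewrite subr_gt0.
exists (M * Gamma (1 - g)); first by rewrite mulr_ge0// ltW// Gamma_gt0.
move=> x; case: (boolP (0 < x <= X)) => xX; last first.
  by rewrite h0// normr0 mulr_ge0 ?rlk_ge0// mulr_ge0// ltW// Gamma_gt0.
have x0 : 0 < x by case/andP: xX.
rewrite (wcont_eq hF xX) normrM (ger0_norm (powR_ge0 _ _)) rlk_gt0E//.
rewrite -mulrA (mulrC (Gamma _)) divfK ?gt_eqF ?Gamma_gt0//.
by rewrite addrAC subrr add0r ler_wpM2r ?powR_ge0.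
Qed.

(** The positive part avoids the default values of [powR] at negative x, which would break
    continuity at 0. *)
Lemma powR_pos_part_continuous (a x : R) : 0 < a ->
  {for x, continuous (fun x : R => (Num.max 0 x) `^ a)}.
Proof.
move=> a0; case: (ltgtP x 0) => x0.
- rewrite /prop_for /continuous_at max_l ?(ltW x0)//.
  have c0 : (fun _ : R => 0 `^ a : R) @ x --> (0 `^ a : R) by exact: cvg_cst.
  apply: cvg_trans c0; apply: near_eq_cvg; near=> y; rewrite max_l//.
  by apply/ltW; near: y; exact: lt_nbhsl.
- have cp : {for x, continuous (fun x : R => x `^ a)}.
    apply: differentiable_continuous; apply/derivable1_diffP.
    by apply: derivable_powR; rewrite in_itv/= x0.
  rewrite /prop_for /continuous_at max_r ?(ltW x0)//; apply: cvg_trans cp.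
  apply: near_eq_cvg; near=> y; rewrite max_r//.
  by apply/ltW; near: y; exact: lt_nbhsr.
- rewrite x0 /prop_for /continuous_at maxxx powR0 ?gt_eqF//.
  apply/cvgrPdist_lt => e e0; near=> y; rewrite sub0r normrN ger0_norm ?powR_ge0//.
  have e' : e = (e `^ a^-1) `^ a by rewrite -powRrM mulVf ?gt_eqF// powRr1 ?ltW.
  rewrite [ltRHS]e'; apply: gt0_ltr_powR => //; rewrite ?nnegrE ?powR_ge0 ?le_max ?lexx//.
  rewrite gt_max powR_gt0//=.
  by near: y; apply: lt_nbhsl; rewrite powR_gt0.
Unshelve. all: by end_near. Qed.

(* The substitution [y = x * u] turns [x ^ g * RL al h x] into [x ^ al] times an
   integral over [0, 1] depending continuously on [x]. *)
Lemma RL_weighted_continuous (g al : R) h : 0 < al -> g < 1 -> wcont g h ->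
  exists F : R -> R, [/\ forall x, 0 <= x <= X -> {for x, continuous F}, F 0 = 0 &
    forall x, 0 < x <= X -> F x = x `^ g * RL al h x].
Proof.
move=> al0 g1 hw; have mh := wcont_measurable hw.
case: hw => [h0 [F [M [cF FM hF]]]].
have g10 : 0 < 1 - g by rewrite subr_gt0.
(* As h (x u) = F (x u) (x u)^(-g), the rescaled integrand is [k u * F (x * u)] up to a power of x
   and Gamma(1 - g). Here [k] is integrable by the Beta integral and [F] is bounded by [M], whence a
   domination uniform in x. *)
pose k u := rlk al (1 - u) * rlk (1 - g) (u - 0).
have mk : measurable_fun [set: R] k.
  apply: measurable_funM; first by apply: measurable_sub_comp; exact: measurable_rlk.
  by apply: (measurableT_comp (@measurable_rlk _ (1 - g))); exact: measurable_funB.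
have k0 u : 0 <= k u by rewrite mulr_ge0 ?rlk_ge0.
pose f x u := k u * F (x * u).
have mf x : measurable_fun [set: R] (f x).
  apply: measurable_funM => //; apply: continuous_measurable_fun => u.
  by apply: continuous_comp; [exact: mulrl_continuous|exact: cF].
pose I x := \int[mu]_u f x u.
have ik : mu.-integrable [set: R] (EFin \o (fun u => M * k u)).
  exact: (integrableZl measurableT M (integrable_rlk_conv 1 0 al0 g10)).
have fM x u : `|f x u| <= M * k u.
  by rewrite normrM (ger0_norm (k0 u)) mulrC ler_wpM2r.
have cI x : 0 <= x <= X -> {for x, continuous I}.
  move=> /andP[x0 xX].
  apply: (@continuity_under_integral R _ _ mu f setT measurableT (-1) (X + 1) _ _ _ ik).
  - move=> y _; apply: le_integrable ik => //.
      by apply/measurable_EFinP; exact: mf.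
    by move=> u _; rewrite /= lee_fin (le_trans (fM y u))// ler_norm.
  - apply: aeW => u _ y _; rewrite /f; apply: cvgM; first exact: cvg_cst.
    apply: (@continuous_comp _ _ _ (fun y : R => y * u) F); last exact: cF.
    exact: mulrr_continuous.
  - by move=> y _; apply: aeW => u _; exact: fM.
  - by rewrite inE/= in_itv/= (lt_le_trans _ x0) ?oppr_lt0//= ltr_pwDr.
exists (fun x => (Num.max 0 x) `^ al * (Gamma (1 - g) * I x)); split.
- move=> x xX; apply: continuousM; first exact: powR_pos_part_continuous.
  by apply: continuousM; [exact: cvg_cst|exact: cI].
- by rewrite maxxx powR0 ?mul0r// gt_eqF.
- move=> x /andP[x0 xX]; rewrite max_r ?(ltW x0)//.
  have -> : RL al h x = \int[mu]_u (x `^ (al - g) * Gamma (1 - g) * f x u).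
    rewrite /RL /Rintegral (integral_scale x0); last exact: measurable_rlk_mul.
    congr fine; apply: eq_integral => u _; congr EFin.
    rewrite /f /k subr0; case: (leP u 0) => u0.
      rewrite (rlk0 _ u0) h0 ?mulr0 ?mul0r ?mulr0//.
      by rewrite negb_and -leNgt mulr_ge0_le0 ?(ltW x0).
    case: (leP 1 u) => u1.
      rewrite rlk0; last by rewrite subr_le0 ler_peMr// ltW.
      by rewrite (@rlk0 _ al (1 - u)) ?subr_le0// !mul0r mulr0.
    have xu : 0 < x * u <= X.
      by rewrite mulr_gt0//= (le_trans _ xX)// ler_piMr// ltW.
    have -> : x - x * u = x * (1 - u) by ring.
    rewrite (wcont_eq hF xu) powRM ?(ltW x0) ?(ltW u0)//.
    rewrite /rlk kernM// (kern_gt0E (1 - g) u0).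
    have -> : 1 - g - 1 = - g by ring.
    have -> : x `^ (al - g) = x `^ (al - 1) * x `^ (- g) * x.
      rewrite -{4}(powRr1 (ltW x0)) !powRDgt0//; congr (_ `^ _); ring.
    by field; rewrite !gt_eqF ?Gamma_gt0.
  rewrite RintegralZl_ge0// [RHS]mulrA [x `^ g * _]mulrA powRDgt0//.
  by have -> : g + (al - g) = al; [ring|rewrite /I mulrA].
Qed.

Lemma RL_wcont (g al : R) h : 0 < al -> g < 1 -> wcont g h ->
  wcont g (fun x => if 0 < x <= X then RL al h x else 0).
Proof.
move=> al0 g1 hw; have [F [cF _ hF]] := RL_weighted_continuous al0 g1 hw.
apply: (@wcont_local g _ F) => //.
- by move=> x /negbTE ->.
- by move=> x xX; rewrite xX hF.
Qed.

End weighted.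

(** * From the differential inequality to the integral one *)
Section residual.
Context {R : realType}.
Notation mu := (@lebesgue_measure R).

Lemma RLD (al x : R) (h1 h2 : R -> R) : RL_integrable al h1 x -> RL_integrable al h2 x ->
  RL_integrable al (fun y => h1 y + h2 y) x /\
  RL al (fun y => h1 y + h2 y) x = RL al h1 x + RL al h2 x.
Proof.
move=> i1 i2; split.
  have := integrableD measurableT i1 i2; apply: eq_integrable => // y _.
  by rewrite /= -EFinD mulrDr.
by rewrite -RintegralD//; apply: eq_Rintegral => y _; rewrite mulrDr.
Qed.

Lemma RL_le0 (al x : R) (h : R -> R) : (forall y, y <= 0 -> h y = 0) -> x <= 0 ->
  RL al h x = 0.
Proof.
move=> h0 x0; rewrite /RL /Rintegral integral0_eq// => y _.
case: (leP y 0) => y0; first by rewrite h0// mulr0.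
by rewrite rlk0 ?mul0r// subr_le0 (le_trans x0)// ltW.
Qed.

Lemma rlk1_subE (x y : R) : rlk 1 (x - y) = \1_(`]-oo, x[%classic) y.
Proof.
rewrite indicE mem_setE in_itv/=; case: (ltP y x) => yx.
  by rewrite rlk1// subr_gt0.
by rewrite rlk0// subr_le0.
Qed.

Lemma RL1_sub (s t : R) (v : R -> R) : s <= t -> mu.-integrable [set: R] (EFin \o v) ->
  RL 1 v t - RL 1 v s = \int[mu]_(y in `[s, t[) v y.
Proof.
move=> st iv.
have E x : RL 1 v x = \int[mu]_(y in `]-oo, x[) v y.
  rewrite [RHS]Rintegral_mkcond; apply: eq_Rintegral => y _.
  by rewrite rlk1_subE patchE indicE; case: (_ \in _); rewrite ?mul1r ?mul0r.
rewrite !E (_ : `]-oo, t[%classic = `]-oo, s[ `|` `[s, t[); last first.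
  by rewrite -itv_bndbnd_setU// bnd_simp.
rewrite Rintegral_setU//.
- by rewrite addrAC subrr add0r.
- by apply: integrableS iv => //; exact: measurableU.
- apply/disj_setPS => y [] /=; rewrite !in_itv/= => ys /andP[sy _].
  by move: (lt_le_trans ys sy); rewrite ltxx.
Qed.

Lemma rlk_le (a x y : R) : 1 <= a -> x <= y -> rlk a x <= rlk a y.
Proof.
move=> a1 xy; have a0 : 0 < a by rewrite (lt_le_trans _ a1).
case: (leP x 0) => x0; first by rewrite rlk0// rlk_ge0.
have y0 : 0 < y by rewrite (lt_le_trans x0).
rewrite !rlk_gt0E// ler_pM2r ?invr_gt0 ?Gamma_gt0//.
by apply: ge0_ler_powR; rewrite ?nnegrE ?subr_ge0// ltW.
Qed.

Lemma rlk_ge (a x y : R) : 0 < a -> a <= 1 -> 0 < x -> x <= y -> rlk a y <= rlk a x.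
Proof.
move=> a0 a1 x0 xy; have y0 : 0 < y by rewrite (lt_le_trans x0).
rewrite !rlk_gt0E// ler_pM2r ?invr_gt0 ?Gamma_gt0//.
have E (z : R) : z `^ (a - 1) = (z `^ (1 - a))^-1 by rewrite -powRN opprB.
rewrite !E lef_pV2 ?posrE ?powR_gt0//.
by apply: ge0_ler_powR; rewrite ?nnegrE ?subr_ge0// ltW.
Qed.

Lemma RL_integrable_ge1 (a x : R) (h : R -> R) : 1 <= a ->
  mu.-integrable [set: R] (EFin \o h) -> (forall y, y <= 0 -> h y = 0) -> RL_integrable a h x.
Proof.
move=> a1 ih h0; have a0 : 0 < a by rewrite (lt_le_trans _ a1).
have mh : measurable_fun [set: R] h by move/integrableP : ih => [/measurable_EFinP].
apply: (le_integrable _ _ _ (integrableZl measurableT (rlk a x) ih)) => //.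
  by apply/measurable_EFinP; exact: measurable_rlk_mul.
move=> y _; rewrite /= lee_fin [leLHS]normrM [leRHS]normrM.
case: (leP y 0) => y0.
  by rewrite h0// normr0 !mulr0.
by rewrite ler_wpM2r// !ger0_norm ?rlk_ge0// rlk_le// gerBl ltW.
Qed.

(** If v x < 0, continuity keeps v below v x / 2 on some interval ending at x, and [RL 1 v] would
    strictly decrease there. *)
Lemma nondecreasing_RL1_ge0 (X x : R) (v : R -> R) :
  (forall t, 0 < t < X -> RL_integrable 1 v t) -> 0 < x < X -> {for x, continuous v} ->
  (forall s t, 0 < s -> s <= t -> t < X -> RL 1 v s <= RL 1 v t) -> 0 <= v x.
Proof.
move=> iv /andP[x0 xX] cv nd; rewrite leNgt; apply/negP => vx0.
have e0 : 0 < - (v x / 2) by rewrite oppr_gt0 pmulr_llt0// invr_gt0.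
move/cvgrPdist_lt : cv => /(_ _ e0)[r /= r0 Hr].
pose s := Num.max (x - r / 2) (x / 2).
have s0 : 0 < s by rewrite lt_max divr_gt0 ?orbT.
have sx : s < x.
  rewrite gt_max; apply/andP; split; first by rewrite ltrBlDr ltrDl divr_gt0.
  by rewrite ltr_pdivrMr// ltr_pMr// ltr1n.
(* The kernel of order 1 is an indicator, so [v1] is [v] cut at x, integrable over the line. *)
pose v1 y := rlk 1 (x - y) * v y.
have iv1 : mu.-integrable [set: R] (EFin \o v1) by apply: iv; rewrite x0.
have v1E y : y < x -> v1 y = v y by move=> yx; rewrite /v1 rlk1 ?mul1r// subr_gt0.
have := nd s x s0 (ltW sx) xX.
have E t : t <= x -> RL 1 v t = RL 1 v1 t.
  by move=> tx; apply: RL_local => y yt; rewrite v1E// (lt_le_trans yt).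
rewrite (E x)// (E s) ?(ltW sx)// -subr_ge0 (RL1_sub (ltW sx) iv1) leNgt => /negP; apply.
have mus : (mu `[s, x[%classic < +oo)%E.
  by rewrite lebesgue_measure_itv/= lte_fin sx -EFinB ltry.
apply: (@le_lt_trans _ _ (\int[mu]_(y in `[s, x[) (v x / 2))).
  apply: le_Rintegral => //.
  - exact: integrableS iv1.
  - apply: measurable_bounded_integrable => //.
    exists `|v x / 2|; split; first exact: num_real.
    by move=> M MM y _; exact: ltW.
  - move=> y /=; rewrite in_itv/= => /andP[sy yx]; rewrite v1E//.
    have H : `|v x - v y| < - (v x / 2).
      apply: Hr => /=; rewrite ger0_norm ?subr_ge0 ?(ltW yx)//.
      rewrite ltrBlDr -ltrBlDl; apply: lt_le_trans sy.
      by rewrite lt_max ltrD2l ltrN2 ltr_pdivrMr// ltr_pMr ?ltr1n.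
    have := ler_norm (v y - v x); rewrite distrC => /le_lt_trans /(_ H).
    by move: (v x) (v y) => a b; lra.
rewrite Rintegral_cst//= lebesgue_measure_itv/= lte_fin sx -EFinB/=.
by rewrite nmulr_rlt0 ?subr_gt0// -oppr_gt0.
Qed.

(** The kernel is nondecreasing for a >= 1, so its increment [d] is a nonnegative weight against
    which the bound on [u] can be integrated. *)
Lemma RL_increment_bound (a s t eps : R) (u : R -> R) : 1 <= a -> s <= t ->
  RL_integrable a u s -> RL_integrable a u t -> (forall y, y < t -> `|u y| <= eps * rlk 1 y) ->
  `|RL a u t - RL a u s| <= eps * (rlk (a + 1) t - rlk (a + 1) s).
Proof.
move=> a1 st us ut ub; have a0 : 0 < a by rewrite (lt_le_trans _ a1).
have [irs rs] := RL_rlk s a0 (@ltr01 R); have [irt rt] := RL_rlk t a0 (@ltr01 R).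
pose d y := rlk a (t - y) - rlk a (s - y).
have d0 y : 0 <= d y by rewrite subr_ge0 rlk_le// lerD2r.
have du : mu.-integrable [set: R] (EFin \o (fun y => d y * u y)).
  have := integrableB measurableT ut us; apply: eq_integrable => // y _.
  by rewrite /= -EFinB mulrBl.
have dr : mu.-integrable [set: R] (EFin \o (fun y => d y * rlk 1 y)).
  have := integrableB measurableT irt irs; apply: eq_integrable => // y _.
  by rewrite /= -EFinB mulrBl.
have -> : RL a u t - RL a u s = \int[mu]_y (d y * u y).
  by rewrite /RL -RintegralB//; apply: eq_Rintegral => y _; rewrite mulrBl.
have -> : eps * (rlk (a + 1) t - rlk (a + 1) s) = \int[mu]_y (eps * (d y * rlk 1 y)).
  rewrite RintegralZl// -rs -rt /RL -RintegralB//; congr (_ * _).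
  by apply: eq_Rintegral => y _; rewrite mulrBl.
apply: le_trans (le_normr_Rintegral measurableT du) _.
apply: le_Rintegral => //.
- exact: integrable_norm.
- exact: (integrableZl measurableT eps dr).
- move=> y _; rewrite normrM ger0_norm// mulrCA.
  case: (ltP y t) => yt; first by rewrite ler_wpM2l// ub.
  have -> : d y = 0 by rewrite /d !rlk0 ?subr0// subr_le0// (le_trans st).
  by rewrite !mul0r.
Qed.

(** By the fundamental theorem on compact subintervals, [G - RL 1 w1] is constant on ]0, x1[. As
    [RL 1 w1] tends to 0 at 0, that constant is the right limit of [G], whose existence is thereby
    obtained. *)
Lemma primitive_at0 (X x1 : R) (G w : R -> R) : 0 < x1 < X ->
  (forall x, 0 < x < X -> is_derive x 1 G (w x)) ->
  let w1 := (w \_ `]0, x1[) in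
  mu.-integrable [set: R] (EFin \o w1) ->
  let c := lim (G @ 0^'+) in
  G @ 0^'+ --> c /\ forall x, 0 < x < x1 -> G x = c + RL 1 w1 x.
Proof.
move=> /andP[x10 x1X] dG w1 iw1 c.
have w10 y : y <= 0 -> w1 y = 0.
  by move=> y0; rewrite /w1 patchE mem_setE in_itv/= ltNge y0.
have w1E y : 0 < y < x1 -> w1 y = w y.
  by move=> yx1; rewrite /w1 patchE mem_setE in_itv/= yx1.
have step s t : 0 < s -> s <= t -> t < x1 -> RL 1 w1 t - RL 1 w1 s = G t - G s.
  move=> s0 st tx1; rewrite RL1_sub// Rintegral_itv_bndo_bndc; last exact: integrableS iw1.
  have eqw : {in `[s, t]%classic, w1 =1 w}.
    move=> y; rewrite inE/= in_itv/= => /andP[sy yt].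
    by rewrite w1E// (lt_le_trans s0 sy) (le_lt_trans yt).
  have -> : \int[mu]_(y in `[s, t]) w1 y = \int[mu]_(y in `[s, t]) w y.
    exact: eq_Rintegral.
  apply: derivable_integral_FTC => //.
    move=> x /andP[sx xt]; apply: dG.
    by rewrite (lt_le_trans s0 sx) (le_lt_trans xt)// (lt_trans tx1).
  have : mu.-integrable `[s, t] (EFin \o w1) by exact: integrableS iw1.
  by apply: eq_integrable => // y /eqw wy; rewrite /= wy.
pose x0 := x1 / 2.
have x00 : 0 < x0 by rewrite divr_gt0.
have x0x1 : x0 < x1 by rewrite ltr_pdivrMr// ltr_pMr// ltr1n.
pose c' := G x0 - RL 1 w1 x0.
have GE x : 0 < x < x1 -> G x = c' + RL 1 w1 x.
  move=> /andP[xx0 xx1]; case: (leP x x0) => xx.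
    have := step x x0 xx0 xx x0x1; rewrite /c'.
    by move: (RL 1 w1 x0) (RL 1 w1 x) (G x0) (G x) => *; lra.
  have := step x0 x x00 (ltW xx) xx1; rewrite /c'.
  by move: (RL 1 w1 x0) (RL 1 w1 x) (G x0) (G x) => *; lra.
have cvR : RL 1 w1 x @[x --> 0^'+] --> (0 : R).
  have i0 : mu.-integrable `[0, x1] (EFin \o w1) by exact: integrableS iw1.
  have := cvg_at_right_filter (parameterized_integral_cvg_left x10 i0).
  apply: cvg_trans; apply: near_eq_cvg; near=> x.
  have xx : 0 < x by near: x; exact: nbhs_right_gt.
  have := RL1_sub (ltW xx) iw1; rewrite (@RL_le0 _ 0)// subr0 => ->.
  by rewrite Rintegral_itv_bndo_bndc//; exact: integrableS iw1.
have cvG : G @ 0^'+ --> c'.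
  rewrite -[X in _ --> X]addr0.
  apply: cvg_trans (cvgD (cvg_cst c') cvR); apply: near_eq_cvg; near=> x.
  rewrite GE//; apply/andP; split; first by near: x; exact: nbhs_right_gt.
  by near: x; exact: nbhs_right_lt.
by have -> : c = c' by exact/cvg_lim.
Unshelve. all: by end_near. Qed.

(** Follows the convention of [RL_int] at order 0, which occurs for nu = 0 and for nu = 1. *)
Definition RL0 (al : R) (h : R -> R) (x : R) : R := if al == 0 then h x else RL al h x.

(** * The residual estimate in the variable x, with [al] for mu and [k] for ystar *)

Section residual_bound.
Variables (X al be eps : R) (k fk w : R -> R).
Hypotheses (X0 : 0 < X) (al0 : 0 < al) (be0 : 0 <= be) (ab1 : al + be <= 1).
Let rho := al + be.
Let ga := 1 - rho.
Hypotheses (kw : wcont X ga k) (fw : wcont X ga fk).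
Hypothesis mw : measurable_fun [set: R] w.
Hypothesis w0 : forall y, y <= 0 -> w y = 0.
Hypothesis dG : forall x, 0 < x < X -> is_derive x 1 (RL0 ga k) (w x).
Hypothesis iw : 0 < be -> forall x, 0 < x < X -> RL_integrable be w x.
Hypothesis weps : forall x, 0 < x < X -> `|RL0 be w x - fk x| <= eps.

Let c := lim (RL0 ga k @ 0^'+).
Let rho0 : 0 < rho. Proof. by rewrite ltr_pwDl. Qed.
Let ga1 : ga < 1. Proof. by rewrite /ga gtrBl. Qed.
Let ga0 : 0 <= ga. Proof. by rewrite subr_ge0. Qed.
Let rhoE : 1 - ga = rho. Proof. by rewrite /ga subKr. Qed.
Let k0 y : y <= 0 -> k y = 0.
Proof. by move=> y0; apply: (proj1 kw); rewrite ltNge y0. Qed.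
Let fk0 y : y <= 0 -> fk y = 0.
Proof. by move=> y0; apply: (proj1 fw); rewrite ltNge y0. Qed.
Let eps0 : 0 <= eps.
Proof.
have X2 : 0 < X / 2 < X by rewrite divr_gt0//= ltr_pdivrMr// ltr_pMr// ltr1n.
exact: le_trans (normr_ge0 _) (weps X2).
Qed.

(** If be > 0, then be <= 1 bounds the kernel of I^be at x1 below by [rlk be x1], so integrability
    against the kernel implies integrability. If be = 0, [w] is within eps of [fk], which is
    dominated by a multiple of [rlk rho]. *)
Let integrable_w x1 : 0 < x1 < X -> mu.-integrable [set: R] (EFin \o (w \_ `]0, x1[)).
Proof.
move=> x1X; have x10 : 0 < x1 by case/andP: x1X.
have mw1 : measurable_fun [set: R] (EFin \o (w \_ `]0, x1[)).
  apply/measurable_EFinP; apply/(measurable_restrictT _ _).1 => //.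
  exact: measurable_funTS.
case: (ltgtP be 0) => be00.
- by move: be0; rewrite leNgt be00.
- have k1 : 0 < rlk be x1 by exact: rlk_gt0.
  apply: (le_integrable _ _ _ (integrableZl measurableT (rlk be x1)^-1 (iw be00 x1X))) => //.
  move=> y _; rewrite /= lee_fin patchE mem_setE in_itv/=.
  case: ifPn => [/andP[y0 yx1]|_]; last by rewrite normr0.
  rewrite mulrA normrM ler_peMl// ger0_norm; last by rewrite mulr_ge0 ?invr_ge0 ?rlk_ge0.
  rewrite ler_pdivlMl// mulr1; apply: rlk_ge => //.
  + by rewrite (le_trans _ ab1)// lerDr ltW.
  + by rewrite subr_gt0.
  + by rewrite gerBl ltW.
- have [M M0 HM] := wcont_bound ga1 fw; rewrite rhoE in HM.
  have [i1 _] := RL_rlk x1 (@ltr01 R) (@ltr01 R).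
  have [i2 _] := RL_rlk x1 (@ltr01 R) rho0.
  have i3 := integrableD measurableT (integrableZl measurableT eps i1)
    (integrableZl measurableT M i2).
  apply: (le_integrable _ _ _ i3) => //.
  move=> y _; rewrite /= lee_fin patchE mem_setE in_itv/=.
  case: ifPn => [/andP[y0 yx1]|_]; last by rewrite normr0.
  have yX : 0 < y < X by rewrite y0 (lt_trans yx1)//; case/andP: x1X.
  have := weps yX; rewrite /RL0 be00 eqxx => H.
  rewrite !rlk1 ?subr_gt0// !mul1r mulr1.
  apply: (@le_trans _ _ (eps + M * rlk rho y)); last exact: ler_norm.
  rewrite -[w y](subrK (fk y)); apply: le_trans (ler_normD _ _) _.
  by apply: lerD.
Qed.

Lemma cvg_RL0_at0 : RL0 ga k @ 0^'+ --> c.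
Proof.
have X2 : 0 < X / 2 < X by rewrite divr_gt0//= ltr_pdivrMr// ltr_pMr// ltr1n.
by have [] := primitive_at0 X2 dG (integrable_w X2).
Qed.

Let restr_w x1 y : y < x1 -> w y = (w \_ `]0, x1[) y.
Proof.
move=> yx1; rewrite patchE mem_setE in_itv/= yx1 andbT.
by case: ltP => // /w0.
Qed.

Let RL1_k x : 0 < x < X -> RL_integrable 1 k x /\
  RL 1 k x = c * rlk (rho + 1) x + RL (rho + 1) w x.
Proof.
(* Integrability of [w] is known only up to points below X, so [w] is truncated at some x1 between x
   and X. *)
move=> /andP[x0 xX]; pose x1 := (x + X) / 2.
have xx1 : x < x1 by rewrite /x1; lra.
have x1X : 0 < x1 < X by apply/andP; split; rewrite /x1; lra.
have iw1 := integrable_w x1X; set w1 := (w \_ `]0, x1[) in iw1.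
have mw1 : measurable_fun [set: R] w1 by move/integrableP : iw1 => [/measurable_EFinP].
have w10 y : y <= 0 -> w1 y = 0.
  by move=> y0; rewrite /w1 patchE mem_setE in_itv/= ltNge y0.
have [_ GE] := primitive_at0 x1X dG iw1; rewrite -/w1 -/c in GE.
have mk := wcont_measurable kw.
have [M M0 HM] := wcont_bound ga1 kw; rewrite rhoE in HM.
have ik a : 0 < a -> RL_integrable a k x.
  by move=> a0; have [] := RL_bound (x := x) a0 rho0 mk (fun y _ => HM y).
split; first exact: ik.
have G0 y : y < x -> RL0 ga k y = c * rlk 1 y + RL 1 w1 y.
  move=> yx; case: (leP y 0) => y0.
    rewrite (rlk0 _ y0) mulr0 add0r (RL_le0 _ w10 y0) /RL0.
    by case: ifP => _; [exact: k0|exact: RL_le0].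
  by rewrite rlk1// mulr1; apply: GE; rewrite y0 (lt_trans yx).
have [ir1 r1] := RL_rlk x rho0 (@ltr01 R).
have [ir2 r2] := RLZ c ir1.
have irw : RL_integrable (rho + 1) w1 x by apply: RL_integrable_ge1 => //; rewrite lerDr ltW.
have [iw2 rw2] := RL_semigroup rho0 (@ltr01 R) mw1 irw.
have [_ rs] := RLD ir2 iw2.
have -> : RL (rho + 1) w x = RL (rho + 1) w1 x.
  by apply: RL_local => y yx; apply: restr_w; exact: lt_trans xx1.
rewrite -r1 -r2 -rw2 -rs -(RL_local _ G0).
(* For ga = 0 the inner operator is the identity and rho = 1; the semigroup law covers positive
   orders. *)
move: ga0; rewrite le_eqVlt => /predU1P[g0|g0].
  have -> : rho = 1 by rewrite -rhoE -g0 subr0.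
  by apply: RL_local => y _; rewrite /RL0 -g0 eqxx.
have -> : RL 1 k x = RL (rho + ga) k x by congr (RL _ k x); rewrite /ga addrC subrK.
have [_ <-] := RL_semigroup rho0 g0 mk (ik _ (addr_gt0 rho0 g0)).
by apply: RL_local => y _; rewrite /RL0 gt_eqF.
Qed.

(** The semigroup law with 1 + al + be = rho + 1; this order is at least 1, so the kernel is bounded
    near its endpoint and integrability of the truncated [w] suffices. *)
Let RL_deriv x : 0 < x < X -> RL_integrable (1 + al) (RL0 be w) x /\
  RL (1 + al) (RL0 be w) x = RL (rho + 1) w x.
Proof.
move=> /andP[x0 xX]; pose x1 := (x + X) / 2.
have xx1 : x < x1 by rewrite /x1; lra.
have x1X : 0 < x1 < X by apply/andP; split; rewrite /x1; lra.
have iw1 := integrable_w x1X; set w1 := (w \_ `]0, x1[) in iw1.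
have mw1 : measurable_fun [set: R] w1 by move/integrableP : iw1 => [/measurable_EFinP].
have w10 y : y <= 0 -> w1 y = 0.
  by move=> y0; rewrite /w1 patchE mem_setE in_itv/= ltNge y0.
have al1 : 0 < 1 + al by rewrite addr_gt0.
have wE y : y < x -> w y = w1 y by move=> yx; apply: restr_w; exact: lt_trans xx1.
have rE : rho + 1 = 1 + al + be by rewrite /rho; ring.
have irw : RL_integrable (rho + 1) w1 x by apply: RL_integrable_ge1 => //; rewrite lerDr ltW.
rewrite (RL_local _ wE) rE.
case: (eqVneq be 0) => be00.
  rewrite be00 addr0; split; last first.
    by apply: RL_local => y yx; rewrite /RL0 eqxx wE.
  move: irw; rewrite rE be00 addr0; apply: RL_integrable_local => y yx.
  by rewrite /RL0 eqxx wE.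
have bep : 0 < be by rewrite lt_neqAle eq_sym be00.
rewrite rE in irw.
have [i1 r1] := RL_semigroup al1 bep mw1 irw.
have E y : y < x -> RL be w1 y = RL0 be w y.
  move=> yx; rewrite /RL0 (negbTE be00); apply: RL_local => z zy.
  by rewrite wE// (lt_trans zy).
by split; [exact: RL_integrable_local i1|rewrite -r1 (RL_local _ E)].
Qed.

Lemma residual_bound x : 0 < x <= X ->
  `|k x - (c * rlk rho x + RL al fk x)| <= eps * rlk (al + 1) x.
Proof.
have mf := wcont_measurable fw.
have [M M0 HM] := wcont_bound ga1 fw; rewrite rhoE in HM.
have al1 : 1 <= 1 + al by rewrite lerDl ltW.
have al10 : 0 < 1 + al by rewrite addr_gt0.
pose u y := RL0 be w y - fk y.
have iu t : 0 < t < X -> RL_integrable (1 + al) u t /\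
    RL (1 + al) u t = RL (rho + 1) w t - RL (1 + al) fk t.
  move=> tX; have [i1 r1] := RL_deriv tX.
  have [i2 _] := RL_bound (x := t) al10 rho0 mf (fun y _ => HM y).
  by have := RLB i1 i2; rewrite r1.
have ub y : y < X -> `|u y| <= eps * rlk 1 y.
  move=> yX; case: (leP y 0) => y0.
    rewrite (rlk0 _ y0) mulr0 /u fk0// subr0 /RL0.
    by case: ifP => _; [rewrite w0// normr0|rewrite (RL_le0 _ w0 y0) normr0].
  by rewrite rlk1// mulr1; apply: weps; rewrite y0.
have [F [cF F0 hF]] := RL_weighted_continuous al0 ga1 fw.
have [_ [K [MK [cK KM hK]]]] := kw.
(* The residual rebuilt from the continuous functions [K] and [F]: unlike [k], which is cut to 0
   beyond X, it is continuous from both sides at X. *)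
pose r y := (K y - F y) * kern (1 - ga) y - c * rlk rho y.
have rE y : y <= X -> r y = k y - (c * rlk rho y + RL al fk y).
  move=> yX; case: (leP y 0) => y0.
    by rewrite /r kern0// rlk0// k0// (RL_le0 _ fk0 y0) !mulr0 addr0 subr0.
  have yX' : 0 < y <= X by rewrite y0.
  rewrite (wcont_eq hK yX') (wcont_eq hF yX') /r kern_gt0E//.
  have -> : 1 - ga - 1 = - ga by ring.
  ring.
have ir t : 0 < t < X -> RL_integrable 1 r t /\ RL 1 r t = RL (1 + al) u t.
  move=> tX; have [ik rk] := RL1_k tX; have [_ ru] := iu t tX.
  have [i1 r1] := RL_rlk t (@ltr01 R) rho0; have [i2 r2] := RLZ c i1.
  have [i3 _] := RL_bound (x := t) al10 rho0 mf (fun y _ => HM y).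
  have [i4 r4] := RL_semigroup (@ltr01 R) al0 mf i3.
  have [i5 r5] := RLD i2 i4; have [i6 r6] := RLB ik i5.
  have E y : y < t -> k y - (c * rlk rho y + RL al fk y) = r y.
    by move=> yt; rewrite rE// (le_trans (ltW yt))// ltW//; case/andP: tX.
  split; first exact: RL_integrable_local i6.
  rewrite -(RL_local _ E) r6 r5 r2 r1 r4 rk ru (addrC 1 rho); ring.
have cr y : 0 < y <= X -> {for y, continuous r}.
  move=> /andP[y0 yX]; apply: continuousB.
    apply: continuousM; last exact: kern_continuous.
    by apply: continuousB; [exact: cK|apply: cF; rewrite ltW].
  apply: continuousM; first exact: cvg_cst.
  by apply: continuousM; [exact: kern_continuous|exact: cvg_cst].
have cerlk y : 0 < y -> {for y, continuous (fun y => eps * rlk (1 + al) y)}.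
  move=> y0; apply: continuousM; first exact: cvg_cst.
  by apply: continuousM; [exact: kern_continuous|exact: cvg_cst].
have increment s t : 0 < s -> s <= t -> t < X ->
    `|RL 1 r t - RL 1 r s| <= eps * (rlk (1 + al + 1) t - rlk (1 + al + 1) s).
  move=> s0 st tX; have t0 : 0 < t by rewrite (lt_le_trans s0).
  have sX : 0 < s < X by rewrite s0 (le_lt_trans st).
  have tX' : 0 < t < X by rewrite t0.
  have [_ ->] := ir _ sX; have [_ ->] := ir _ tX'.
  have [ius _] := iu _ sX; have [iut _] := iu _ tX'.
  by apply: RL_increment_bound => // y yt; apply: ub; exact: lt_trans tX.
(* Taking sg = 1 and sg = -1 recovers the absolute value. For either sign, [increment] says that
   [RL 1 v] is nondecreasing. *)
have sgn_bound (sg t : R) : `|sg| = 1 -> 0 < t <= X ->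
    0 <= eps * rlk (1 + al) t - sg * r t.
  move=> sg1; pose v y := eps * rlk (1 + al) y - sg * r y.
  have iv z : 0 < z < X -> RL_integrable 1 v z /\
      RL 1 v z = eps * rlk (1 + (1 + al)) z - sg * RL 1 r z.
    move=> zX; have [i1 r1] := RL_rlk z (@ltr01 R) al10; have [i2 r2] := RLZ eps i1.
    have [i3 _] := ir _ zX; have [i4 r4] := RLZ sg i3.
    by have := RLB i2 i4; rewrite r2 r1 r4.
  have cv y : 0 < y <= X -> {for y, continuous v}.
    move=> yX; apply: continuousB; first by apply: cerlk; case/andP: yX.
    by apply: continuousM; [exact: cvg_cst|exact: cr].
  have v0 z : 0 < z < X -> 0 <= v z.
    move=> zX; apply: (@nondecreasing_RL1_ge0 X z v _ zX).
    - by move=> y /iv[].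
    - by apply: cv; case/andP: zX => -> /ltW ->.
    - move=> s y s0 sy yX; have y0 : 0 < y by rewrite (lt_le_trans s0).
      have sX : 0 < s < X by rewrite s0 (le_lt_trans sy).
      have yX' : 0 < y < X by rewrite y0.
      have [_ ->] := iv _ sX; have [_ ->] := iv _ yX'.
      have := increment s y s0 sy yX; rewrite [1 + al + 1]addrC.
      have := ler_norm (sg * (RL 1 r y - RL 1 r s)); rewrite normrM sg1 mul1r.
      have aux (p q m n : R) : p - q <= m - n -> n - q <= m - p by move=> *; lra.
      by move=> h1 h2; apply: aux; rewrite -!mulrBr; exact: le_trans h1 h2.
  move=> /andP[t0]; rewrite le_eqVlt => /predU1P[tX|tX]; last by apply: v0; rewrite t0.
  (* The hypotheses concern the open interval; the endpoint is reached by left continuity. *)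
  rewrite tX -/(v X).
  have cvX : v @ X^'- --> v X by apply: cvg_at_left_filter; apply: cv; rewrite X0 lexx.
  apply: (cvgr_to_ge cvX); near=> y; apply: v0; apply/andP; split.
    by near: y; exact: nbhs_left_gt.
  by near: y; exact: nbhs_left_lt.
move=> xX; rewrite -rE; last by case/andP: xX.
have := sgn_bound 1 x (normr1 _) xX; have := sgn_bound (-1) x (normrN1 _) xX.
rewrite mulN1r opprK mul1r (addrC al) ler_norml.
move: (eps * rlk _ x) (r x) => p q h1 h2.
by apply/andP; split; lra.
Unshelve. all: by end_near. Qed.

End residual_bound.
End residual.

(** * Picard iteration *)
Section picard.
Context {R : realType}.
Notation mu := (@lebesgue_measure R).

Definition ml_term (al z : R) (n : nat) : R := z ^+ n / Gamma (n%:R * al + 1).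

Lemma ml_term_ge0 (al z : R) n : 0 <= al -> 0 <= z -> 0 <= ml_term al z n.
Proof.
move=> al0 z0; rewrite divr_ge0 ?exprn_ge0// ltW// Gamma_gt0//.
by rewrite ltr_wpDl// mulr_ge0.
Qed.

Lemma is_cvg_ml_series (al z : R) : 0 < al -> 0 <= z -> cvgn (series (ml_term al z)).
Proof.
move=> al0 z0.
have z1 : 0 < z + 1 by rewrite ltr_wpDl.
(* Then A^al = 2 (z + 1), and [Gamma_ge] makes the n-th term at most e^(A+1) / 2^n; the [+ 1] keeps
   the base positive when z = 0. *)
pose A := (2 * (z + 1)) `^ al^-1.
have A0 : 0 < A by apply: powR_gt0; apply: mulr_gt0.
have AE : A `^ al = 2 * (z + 1).
  by rewrite /A -powRrM mulVf ?gt_eqF// powRr1// mulr_ge0// ltW.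
apply: (@series_le_cvg _ _ (geometric (expR (A + 1)) 2^-1)).
- by move=> n; exact: ml_term_ge0 (ltW al0) z0.
- by move=> n; rewrite /= mulr_ge0 ?expR_ge0// exprn_ge0.
- move=> n; rewrite /ml_term /=.
  have a1 : 1 <= n%:R * al + 1 by rewrite lerDr mulr_ge0// ltW.
  have HG := Gamma_ge a1 A0.
  have E : A `^ (n%:R * al + 1 - 1) = (2 * (z + 1)) ^+ n.
    rewrite addrK mulrC powRrM AE powR_mulrn//.
    by rewrite mulr_ge0// ltW.
  rewrite {}E mulrC in HG.
  rewrite ler_pdivrMr; last by rewrite Gamma_gt0// (lt_le_trans _ a1).
  apply: le_trans (ler_wpM2l _ HG); last by rewrite mulr_ge0 ?expR_ge0// exprn_ge0.
  rewrite mulrACA -expRD addrN expR0 mul1r -exprMn mulKf// lerXn2r ?nnegrE ?(ltW z1)//.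
  by rewrite lerDl.
- by apply: is_cvg_geometric_series; rewrite ger0_norm// invf_lt1// ltr1n.
Qed.

(** Source of the [- 1] in the final constant: the Picard steps produce the terms from index 1 on,
    and the term of index 0 is 1 / Gamma(1) = 1. *)
Lemma mittag_leffler_tail (al z : R) : 0 < al -> 0 <= z ->
  series (fun n => ml_term al z n.+1) @ \oo --> mittag_leffler al z - 1.
Proof.
move=> al0 z0; have cv : series (ml_term al z) @ \oo --> mittag_leffler al z.
  exact: is_cvg_ml_series.
have E : series (fun n => ml_term al z n.+1) =
    (fun n => series (ml_term al z) n.+1 - 1).
  apply/funext => n; rewrite /series/= big_nat_recl//= /ml_term expr0 mul0r add0r Gamma1.
  by rewrite divr1 addrAC subrr add0r.
rewrite E; apply: cvgB; last exact: cvg_cst.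
by rewrite (cvg_shiftS (series (ml_term al z))).
Qed.

Variables (X al rho L eps c : R) (f : R -> R -> R) (k : R -> R).
Let ga := 1 - rho.
Hypotheses (X0 : 0 < X) (al0 : 0 < al) (rho0 : 0 < rho) (rho1 : rho <= 1)
  (L0 : 0 < L) (eps0 : 0 <= eps).
Hypothesis f0 : forall x v, ~~ (0 < x <= X) -> f x v = 0.
Hypothesis fW : forall h, wcont X ga h -> wcont X ga (fun x => f x (h x)).
Hypothesis fL : forall x u v, `|f x u - f x v| <= L * `|u - v|.
Hypothesis kW : wcont X ga k.
Hypothesis kres : forall x, 0 < x <= X ->
  `|k x - (c * rlk rho x + RL al (fun s => f s (k s)) x)| <= eps * rlk (al + 1) x.

Let ga1 : ga < 1. Proof. by rewrite /ga gtrBl. Qed.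
Let rhoE : 1 - ga = rho. Proof. by rewrite /ga subKr. Qed.

Let wRL_integrable a h x : 0 < a -> wcont X ga h -> RL_integrable a h x.
Proof.
move=> a0 hW; have [M M0 HM] := wcont_bound ga1 hW.
have ga10 : 0 < 1 - ga by rewrite rhoE.
by have [] := RL_bound (x := x) a0 ga10 (wcont_measurable hW) (fun y _ => HM y).
Qed.

Definition picard (h : R -> R) (x : R) : R :=
  if 0 < x <= X then c * rlk rho x + RL al (fun s => f s (h s)) x else 0.

(** The weighted value at 0 is the same for every [h], because the weighted integral term vanishes
    there. Hence all later iterates agree at 0 and their limit stays continuous at 0. *)
Let picard_weighted h : wcont X ga h -> exists F : R -> R,
  [/\ forall x, 0 <= x <= X -> {for x, continuous F}, F 0 = c / Gamma rho &
      forall x, 0 < x <= X -> F x = x `^ ga * picard h x].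
Proof.
move=> hW; have [F [cF F0 hF]] := RL_weighted_continuous al0 ga1 (fW hW).
exists (fun x => c / Gamma rho + F x); split.
- by move=> x xX; apply: continuousD; [exact: cvg_cst|exact: cF].
- by rewrite F0 addr0.
- move=> x xX; have x0 : 0 < x by case/andP: xX.
  rewrite hF// /picard xX mulrDr; congr (_ + _).
  rewrite rlk_gt0E// mulrCA [x `^ ga * _]mulrA powRDgt0//.
  by have -> : ga + (rho - 1) = 0; [rewrite /ga; ring|rewrite powRr0 mul1r].
Qed.

Let picard_wcont h : wcont X ga h -> wcont X ga (picard h).
Proof.
move=> hW; have [F [cF _ hF]] := picard_weighted hW.
apply: (@wcont_local _ X X0 ga _ F) => //.
by move=> x /negbTE xX; rewrite /picard xX.
Qed.

Let picardB h1 h2 M b x : 0 < b -> wcont X ga h1 -> wcont X ga h2 ->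
  (forall s, 0 < s <= X -> `|h1 s - h2 s| <= M * rlk b s) -> 0 < x <= X -> 0 <= M ->
  `|picard h1 x - picard h2 x| <= L * M * rlk (al + b) x.
Proof.
move=> b0 h1W h2W HM xX M0; rewrite /picard xX opprD addrACA subrr add0r.
have f1W := fW h1W; have f2W := fW h2W.
have [_ <-] := RLB (wRL_integrable x al0 f1W) (wRL_integrable x al0 f2W).
have mf : measurable_fun [set: R] (fun s => f s (h1 s) - f s (h2 s)).
  by apply: measurable_funB; [exact: wcont_measurable f1W|exact: wcont_measurable f2W].
have H y : y < x -> `|f y (h1 y) - f y (h2 y)| <= L * M * rlk b y.
  move=> _; case: (boolP (0 < y <= X)) => yX; last first.
    by rewrite !f0// subrr normr0 mulr_ge0 ?rlk_ge0// mulr_ge0// ltW.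
  apply: le_trans (fL _ _ _) _; rewrite -mulrA ler_wpM2l ?(ltW L0)//.
  exact: HM.
by have [_] := RL_bound al0 b0 mf H.
Qed.

Let y n := iter n picard k.
Let yW n : wcont X ga (y n). Proof. by elim: n => [|n IH]; [|exact: picard_wcont]. Qed.

Let y_step n x : 0 < x <= X ->
  `|y n.+1 x - y n x| <= eps * L ^+ n * rlk (n.+1%:R * al + 1) x.
Proof.
elim: n x => [|n IH] x xX.
  (* The first step is the residual of [k]; each further one gains a factor L and al in the
     order. *)
  by rewrite expr0 mulr1 mul1r distrC /y/= /picard xX; exact: kres.
have b0 : 0 < n.+1%:R * al + 1 by rewrite addr_gt0// mulr_gt0.
have M0 : 0 <= eps * L ^+ n by rewrite mulr_ge0// exprn_ge0// ltW.
have := picardB b0 (yW n.+1) (yW n) IH xX M0.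
have -> : L * (eps * L ^+ n) = eps * L ^+ n.+1 by rewrite exprS; ring.
by have -> : al + (n.+1%:R * al + 1) = n.+2%:R * al + 1 by rewrite -[n.+2]addn1 natrD; ring.
Qed.

(** The bound of [y_step] at x = X, namely eps L^n X^((n+1)al) / Gamma((n+1)al+1), rewritten as a
    Mittag-Leffler term; raising L^n to L^(n+1) costs the division by L. *)
Let a n := eps / L * ml_term al (L * X `^ al) n.+1.
Let A := series a.
Let S := eps / L * (mittag_leffler al (L * X `^ al) - 1).

Let LX0 : 0 <= L * X `^ al. Proof. by rewrite mulr_ge0 ?powR_ge0// ltW. Qed.

Let a0 n : 0 <= a n.
Proof. exact: mulr_ge0 (divr_ge0 eps0 (ltW L0)) (ml_term_ge0 _ (ltW al0) LX0). Qed.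

Let A_cvg : A @ \oo --> S.
Proof.
have -> : A = (fun n => eps / L * series (fun n => ml_term al (L * X `^ al) n.+1) n).
  by apply/funext => n; rewrite /A /series/= big_distrr.
by apply: cvgM; [exact: cvg_cst|exact: mittag_leffler_tail].
Qed.

Let A_le_S n : A n <= S.
Proof.
rewrite -(cvg_lim (@Rhausdorff R) A_cvg); apply: nondecreasing_cvgn_le.
  by apply/nondecreasing_series => m _ _; exact: a0.
by apply/cvg_ex; exists S; exact: A_cvg.
Qed.

Let y_step_a n x : 0 < x <= X -> `|y n.+1 x - y n x| <= a n.
Proof.
move=> xX; have [x0 xX'] := andP xX; apply: le_trans (y_step n xX) _.
have b0 : 0 < n.+1%:R * al + 1 by rewrite addr_gt0// mulr_gt0.
have -> : eps * L ^+ n * rlk (n.+1%:R * al + 1) x = eps / L * ml_term al (L * x `^ al) n.+1.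
  rewrite rlk_gt0E// addrK /ml_term exprMn (mulrC n.+1%:R) powRrM.
  rewrite powR_mulrn ?powR_ge0// [L ^+ n.+1]exprS.
  have : L != 0 by rewrite gt_eqF.
  by move: (Gamma _)^-1 ((x `^ al) ^+ n.+1) => p q L0'; field.
rewrite /a ler_wpM2l ?divr_ge0 ?(ltW L0)// /ml_term ler_wpM2r//.
  by rewrite invr_ge0 ltW// Gamma_gt0.
rewrite lerXn2r ?nnegrE//; first by rewrite mulr_ge0 ?powR_ge0// ltW.
rewrite ler_wpM2l ?(ltW L0)//; apply: ge0_ler_powR; rewrite ?nnegrE ?(ltW x0)// ltW//.
Qed.

Let y_dist n m x : 0 < x <= X -> (n <= m)%N -> `|y m x - y n x| <= A m - A n.
Proof.
move=> xX; elim: m => [|m IH]; first by rewrite leqn0 => /eqP ->; rewrite !subrr normr0.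
rewrite leq_eqVlt => /predU1P[->|]; first by rewrite !subrr normr0.
rewrite ltnS => /IH {}IH.
have -> : y m.+1 x - y n x = (y m.+1 x - y m x) + (y m x - y n x) by ring.
have -> : A m.+1 - A n = a m + (A m - A n).
  by rewrite /A /series/= big_nat_recr//=; ring.
by apply: le_trans (ler_normD _ _) _; apply: lerD => //; exact: y_step_a.
Qed.

Let y_is_cvg x : cvgn (y ^~ x).
Proof.
case: (boolP (0 < x <= X)) => xX; last first.
  apply/cvg_ex; exists 0; apply: cvg_near_cst; near=> n.
  exact: (proj1 (yW n)).
have cs : cvgn (series (fun n => y n.+1 x - y n x)).
  apply: normed_cvg; apply: (@series_le_cvg _ _ a) => //.
  - by move=> n; exact: normr_ge0.
  - by move=> n; exact: y_step_a.
  - by apply/cvg_ex; exists S; exact: A_cvg.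
have -> : y ^~ x = (fun n => series (fun n => y n.+1 x - y n x) n + y 0%N x).
  by apply/funext => n; rewrite /series/= telescope_sumr// subrK.
by apply: is_cvgD => //; exact: is_cvg_cst.
Unshelve. all: by end_near. Qed.

Let ylim x := limn (y ^~ x).

Let ylim_dist n x : 0 < x <= X -> `|ylim x - y n x| <= S - A n.
Proof.
move=> xX.
have cv : (fun m => `|y m x - y n x|) @ \oo --> `|ylim x - y n x|.
  by apply: cvg_norm; apply: cvgB; [exact: y_is_cvg|exact: cvg_cst].
apply: (cvgr_to_le cv); near=> m.
apply: (@le_trans _ _ (A m - A n)); last by rewrite lerD2r A_le_S.
by apply: y_dist => //; near: m; exact: nbhs_infty_ge.
Unshelve. all: by end_near. Qed.

Let ylim0 x : ~~ (0 < x <= X) -> ylim x = 0.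
Proof.
move=> xX; rewrite /ylim; apply: cvg_lim; first exact: Rhausdorff.
by apply: cvg_near_cst; near=> n; exact: (proj1 (yW n)).
Unshelve. all: by end_near. Qed.

Let tail_cvg : (fun n => S - A n) @ \oo --> (0 : R).
Proof. by rewrite -[X in _ --> X](subrr S); apply: cvgB; [exact: cvg_cst|exact: A_cvg]. Qed.

(** The weighted iterates converge uniformly on [0, X], and a uniform limit of continuous functions
    is continuous. *)
Let ylim_wcont : wcont X ga ylim.
Proof.
have /choice[F HF] n := picard_weighted (yW n).
(* The value at 0 is the common weighted value of the iterates. *)
pose G x := if x == 0 then c / Gamma rho else x `^ ga * ylim x.
(* [F n] is the weighted form of [picard (y n)], that is of [y n.+1]; hence the index of [A]. *)
have GF n x : 0 <= x <= X -> `|G x - F n x| <= X `^ ga * (S - A n.+1).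
  have [_ Fn0 hFn] := HF n.
  move=> /andP[+ xX]; rewrite le_eqVlt => /predU1P[<-|x0].
    rewrite /G eqxx Fn0 subrr normr0 mulr_ge0 ?powR_ge0//.
    by rewrite subr_ge0 A_le_S.
  have xX' : 0 < x <= X by rewrite x0.
  rewrite /G gt_eqF// hFn// -[picard (y n) x]/(y n.+1 x) -mulrBr normrM.
  rewrite ger0_norm ?powR_ge0//; apply: ler_pM; rewrite ?powR_ge0 ?normr_ge0//.
    apply: ge0_ler_powR; rewrite ?nnegrE ?(ltW x0) ?(ltW X0)//.
    by rewrite /ga subr_ge0.
  exact: ylim_dist.
apply: (@wcont_local _ X X0 ga _ (G \o clamp X)).
- exact: ylim0.
- move=> x _; apply/cvgrPdist_lt => e e0.
  have e30 : 0 < e / 3 / (X `^ ga) by rewrite divr_gt0 ?powR_gt0// divr_gt0.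
  move/cvgrPdist_lt : tail_cvg => /(_ _ e30)[N _ /(_ N.+1 (leqnSn N))/=].
  rewrite sub0r normrN => HN; have {}HN := le_lt_trans (ler_norm _) HN.
  have {}HN : X `^ ga * (S - A N.+1) < e / 3.
    by rewrite mulrC -ltr_pdivlMr// powR_gt0.
  have [cFN _ _] := HF N.
  have cc : {for x, continuous (F N \o clamp X)}.
    by apply: continuous_comp; [exact: clamp_continuous|apply: cFN; exact: clamp_itv].
  move/cvgrPdist_lt : cc => /(_ (e / 3)) cc; near=> z.
  have Hx := le_lt_trans (GF N _ (clamp_itv X0 x)) HN.
  have Hz := le_lt_trans (GF N _ (clamp_itv X0 z)) HN.
  have Hxz : `|(F N \o clamp X) x - (F N \o clamp X) z| < e / 3.
    by near: z; apply: cc; rewrite divr_gt0.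
  rewrite /= in Hxz *.
  have -> : G (clamp X x) - G (clamp X z) = (G (clamp X x) - F N (clamp X x)) +
      (F N (clamp X x) - F N (clamp X z)) - (G (clamp X z) - F N (clamp X z)) by ring.
  apply: le_lt_trans (ler_normB _ _) _.
  apply: le_lt_trans (lerD (ler_normD _ _) (lexx _)) _.
  rewrite [ltRHS](_ : e = e / 3 + e / 3 + e / 3); last by lra.
  by apply: ltrD => //; apply: ltrD.
- move=> x xX; have [x0 xX'] := andP xX.
  by rewrite /= clamp_id ?(ltW x0)// /G gt_eqF.
Unshelve. all: by end_near. Qed.

Let ylim_fix x : 0 < x <= X -> ylim x = picard ylim x.
Proof.
move=> xX.
have cv : (fun n => y n.+1 x) @ \oo --> picard ylim x.
  apply/cvgrPdist_le => e e0.
  pose K := L * rlk (al + 1) x.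
  have K0 : 0 <= K by rewrite mulr_ge0 ?(ltW L0)// rlk_ge0// addr_gt0.
  have K10 : 0 < K + 1 by rewrite ltr_wpDl.
  have eK : 0 < e / (K + 1) by rewrite divr_gt0.
  move/cvgrPdist_lt : tail_cvg => /(_ _ eK) tc; near=> n.
  have tn : S - A n < e / (K + 1).
    have : `|0 - (S - A n)| < e / (K + 1) by near: n; exact: tc.
    by rewrite sub0r normrN; apply: le_lt_trans; exact: ler_norm.
  have tn0 : 0 <= S - A n by rewrite subr_ge0.
  (* A uniform bound is a multiple of [rlk 1], so [picardB] applies with b = 1 and gives continuity
     of [picard] along the iterates. *)
  have H s : 0 < s <= X -> `|ylim s - y n s| <= (S - A n) * rlk 1 s.
    by move=> sX; rewrite rlk1 ?mulr1; [exact: ylim_dist|case/andP: sX].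
  have := picardB ltr01 ylim_wcont (yW n) H xX tn0.
  move/le_trans; apply.
  rewrite mulrAC -/K; apply: (@le_trans _ _ ((K + 1) * (S - A n))).
    by rewrite ler_wpM2r// lerDl.
  by rewrite mulrC -ler_pdivlMr// ltW.
have cv' : (fun n => y n.+1 x) @ \oo --> ylim x.
  by rewrite (cvg_shiftS (y ^~ x)); exact: y_is_cvg.
by apply: (cvg_unique (@Rhausdorff R) cv' cv).
Unshelve. all: by end_near. Qed.

Theorem picard_stability : exists z : R -> R,
  [/\ wcont X ga z,
      forall x, 0 < x <= X -> z x = c * rlk rho x + RL al (fun s => f s (z s)) x &
      forall x, 0 < x <= X ->
        `|k x - z x| <= (mittag_leffler al (L * X `^ al) - 1) / L * eps].
Proof.
exists ylim; split.
- exact: ylim_wcont.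
- by move=> x xX; rewrite {1}ylim_fix// /picard xX.
(* At n = 0 the iterate is [k] and the partial sum [A 0] is empty. *)
- move=> x xX; rewrite distrC; have := ylim_dist 0 xX.
  rewrite /A /series/= big_geq// subr0 /S => /le_trans; apply.
  by rewrite mulrC mulrA [leRHS]mulrAC.
Qed.

End picard.

(** * Measurability of derivatives *)
Section derivative_measurability.
Context {R : realType}.
Notation mu := (@lebesgue_measure R).

(** The derivative is the pointwise limit of the difference quotients of step 1/(n+1), which
    eventually stay inside ]a, b[. *)
Lemma measurable_is_derive (a b : R) (G w : R -> R) :
  measurable_fun [set: R] (fun x => if a < x < b then G x else 0) ->
  (forall x, a < x < b -> is_derive x 1 G (w x)) ->
  measurable_fun [set: R] (fun x => if a < x < b then w x else 0).
Proof.
move=> mG dG; set Gt := (fun x => if a < x < b then G x else 0) in mG.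
pose q (n : nat) x := n.+1%:R * (Gt (x + n.+1%:R^-1) - Gt x).
have -> : (fun x => if a < x < b then w x else 0) = w \_ `]a, b[.
  by apply/funext => x; rewrite patchE mem_setE in_itv.
apply/(measurable_restrictT _ _).1 => //.
apply: (@measurable_fun_cvg _ _ _ _ q) => //.
  move=> n; apply: measurable_funTS; apply: measurable_funM => //.
  apply: measurable_funB => //; apply: (measurableT_comp mG).
  exact: measurable_funD.
move=> x /=; rewrite in_itv/= => xab; have [ax xb] := andP xab.
have dx := dG _ xab; have bx : 0 < b - x by rewrite subr_gt0.
have cvd : (fun h : R => h^-1 *: (G (h *: 1 + x) - G x)) @ 0^' --> w x.
  rewrite -[X in _ --> X](@derive_val _ _ _ _ _ _ _ dx).
  exact: (@ex_derive _ _ _ _ _ _ _ dx).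
have hn : (fun n : nat => n.+1%:R^-1 : R) @ \oo --> 0^'.
  have h0 : (fun n : nat => n.+1%:R^-1 : R) @ \oo --> (0 : R) by exact: cvg_harmonic.
  move=> A [e /= e0 HA].
  move/cvgrPdist_lt : h0 => /(_ _ e0)[N _ HN].
  exists N => // n Nn; apply: HA => /=; first exact: HN.
  by rewrite invr_eq0 pnatr_eq0.
have := cvg_comp _ _ hn cvd; apply: cvg_trans; apply: near_eq_cvg; near=> n.
have xn : x + n.+1%:R^-1 < b.
  by rewrite -ltrBrDl; near: n; exact: (near_infty_natSinv_lt (PosNum bx)).
rewrite /q /= /Gt xab (_ : a < x + n.+1%:R^-1 < b); last first.
  by rewrite xn andbT (lt_trans ax)// ltrDl.
by rewrite invrK /GRing.scale/= mulr1 [x + _]addrC.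
Unshelve. all: by end_near. Qed.

Lemma RL0_measurable (X ga : R) (k : R -> R) : 0 < X -> 0 <= ga -> ga < 1 ->
  wcont X ga k -> measurable_fun [set: R] (fun x => if 0 < x < X then RL0 ga k x else 0).
Proof.
move=> X0 ga0 ga1 kW.
have -> : (fun x => if 0 < x < X then RL0 ga k x else 0) =
    (fun x => if 0 < x <= X then RL0 ga k x else 0) \* \1_(`]0, X[%classic).
  apply/funext => x /=; rewrite indicE mem_setE in_itv/=.
  case: (boolP (0 < x < X)) => [/andP[-> /ltW ->]|_]; first by rewrite mulr1.
  by rewrite mulr0.
apply: measurable_funM; last exact: measurable_indic.
case: (eqVneq ga 0) => g0.
  have -> : (fun x => if 0 < x <= X then RL0 ga k x else 0) = k.
    apply/funext => x; rewrite /RL0 g0 eqxx; case: ifPn => // xX.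
    by rewrite (proj1 kW).
  exact: wcont_measurable kW.
have gp : 0 < ga by rewrite lt_neqAle eq_sym g0.
have -> : (fun x => if 0 < x <= X then RL0 ga k x else 0) =
    (fun x => if 0 < x <= X then RL ga k x else 0).
  by apply/funext => x; rewrite /RL0 (negbTE g0).
exact: wcont_measurable (RL_wcont X0 gp ga1 kW).
Qed.

End derivative_measurability.

(** * Transfer along Psi *)
Section transfer.
Context {R : realType}.
Notation leb := (@lebesgue_measure R).
Variables (a b : R) (Psi dPsi : R -> R).
Hypothesis ab : a < b.
Hypothesis cPsi : {within `[a, b], continuous Psi}.
Hypothesis dPsi1 : forall t, a < t < b -> derivable Psi t 1.
Hypothesis cdPsi : {within `[a, b], continuous dPsi}.
Hypothesis dPsiE : forall t, a < t < b -> derive1 Psi t = dPsi t.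
Hypothesis dPsi_neq0 : forall t, a <= t <= b -> dPsi t != 0.
Hypothesis ndPsi : forall x y, a <= x -> x <= y -> y <= b -> Psi x <= Psi y.

Let X := Psi b - Psi a.

Lemma Psi_is_derive t : a < t < b -> is_derive t 1 Psi (dPsi t).
Proof.
by move=> tab; apply: DeriveDef; [exact: dPsi1|rewrite -derive1E; exact: dPsiE].
Qed.

(** Monotonicity makes the difference quotients nonnegative, and the derivative does not vanish. *)
Lemma dPsi_gt0 t : a < t < b -> 0 < dPsi t.
Proof.
move=> tab; have [ta tb] := andP tab.
rewrite lt_neqAle eq_sym dPsi_neq0 ?(ltW ta) ?(ltW tb)//=.
have dt := Psi_is_derive tab.
have cvd : (fun h : R => h^-1 *: (Psi (h *: 1 + t) - Psi t)) @ 0^' --> dPsi t.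
  rewrite -[X in _ --> X](@derive_val _ _ _ _ _ _ _ dt).
  exact: (@ex_derive _ _ _ _ _ _ _ dt).
apply: (cvgr_to_ge cvd).
have e0 : 0 < Num.min (t - a) (b - t) by rewrite lt_min !subr_gt0 ta tb.
exists (Num.min (t - a) (b - t)) => // h /=; rewrite sub0r normrN lt_min => /andP[h1 h2] h0.
rewrite /GRing.scale/= mulr1.
have ah : a <= h + t by have := ler_norm (- h); rewrite normrN; lra.
have hb : h + t <= b by have := ler_norm h; lra.
case: (ltgtP h 0) => hs.
- by rewrite mulr_le0// ?invr_le0 ?(ltW hs)// subr_le0 ndPsi ?gerDr ?(ltW hs)// ltW.
- by rewrite mulr_ge0// ?invr_ge0 ?(ltW hs)// subr_ge0 ndPsi ?lerDr ?(ltW hs)// ltW.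
- by rewrite hs eqxx in h0.
Qed.

Lemma Psi_incr x y : a <= x -> x < y -> y <= b -> Psi x < Psi y.
Proof.
apply: gtr0_derive1_incr => //.
by move=> t; rewrite in_itv/= => tab; rewrite dPsiE// dPsi_gt0.
Qed.

Lemma X_gt0 : 0 < X. Proof. by rewrite subr_gt0 Psi_incr. Qed.

(* [Psi - Psi a] extended to an increasing bijection of R, with slope 1 outside
   of [a, b]. *)
Definition ext (t : R) : R :=
  if t < a then t - a else if t <= b then Psi t - Psi a else X + (t - b).

Definition dext (t : R) : R := if a < t < b then dPsi t else 1.

Lemma ext_in t : a <= t <= b -> ext t = Psi t - Psi a.
Proof. by move=> /andP[ta tb]; rewrite /ext ltNge ta/= tb. Qed.

Lemma ext_le t : t <= a -> ext t = t - a.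
Proof.
rewrite /ext le_eqVlt => /predU1P[->|->//].
by rewrite ltxx (ltW ab) !subrr.
Qed.

Lemma ext_ge t : b <= t -> ext t = X + (t - b).
Proof.
rewrite /ext le_eqVlt => /predU1P[<-|bt]; first by rewrite ltNge (ltW ab)/= lexx subrr addr0.
by rewrite ltNge (ltW (lt_trans ab bt))/= leNgt bt.
Qed.

Lemma ext_incr : {homo ext : x y / x < y}.
Proof.
have X0 := X_gt0.
have lo x y : x < y -> y <= a -> ext x < ext y.
  by move=> xy ya; rewrite !ext_le ?(le_trans (ltW xy))// ltrD2r.
have mid x y : a <= x -> x < y -> y <= b -> ext x < ext y.
  move=> ax xy yb; rewrite !ext_in ?ltrD2r ?Psi_incr//.
    by rewrite yb (le_trans ax)// ltW.
  by rewrite ax (le_trans (ltW xy)).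
have hi x y : b <= x -> x < y -> ext x < ext y.
  by move=> bx xy; rewrite !ext_ge ?(le_trans bx (ltW xy))// ltrD2l ltrD2r.
have lomid x y : x < y -> y <= b -> ext x < ext y.
  move=> xy yb; case: (ltP x a) => xa; last exact: mid.
  case: (leP y a) => ya; first exact: lo.
  by apply: (lt_trans (lo x a xa (lexx _))); exact: mid.
move=> x y xy; case: (leP y b) => yb; first exact: lomid.
case: (ltP x b) => xb; last exact: hi.
by apply: (lt_trans (lomid x b xb (lexx _))); exact: hi.
Qed.

Lemma ext_mono : {mono ext : x y / x <= y}.
Proof. exact: le_mono ext_incr. Qed.

Lemma ext_surj y : exists x, ext x = y.
Proof.
have X0 := X_gt0.
case: (ltP y 0) => y0.
  by exists (y + a); rewrite ext_le ?addrK// gerDr ltW.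
case: (leP y X) => yX; last first.
  by exists (b + (y - X)); rewrite ext_ge ?lerDl ?subr_ge0 ?(ltW yX)//; ring.
have ab' := ltW ab.
have Pab : Psi a <= Psi b by exact: ndPsi.
have [|t] := @IVT R Psi a b (y + Psi a) ab' cPsi.
  by rewrite (min_l Pab) (max_r Pab) lerDr y0/= -lerBrDr.
by rewrite in_itv/= => tab Pt; exists t; rewrite ext_in// Pt addrK.
Qed.

Lemma dext_ge0 t : 0 <= dext t.
Proof. by rewrite /dext; case: ifP => // /dPsi_gt0/ltW. Qed.

Lemma measurable_dext : measurable_fun [set: R] dext.
Proof.
have m : measurable_fun [set: R] (dPsi \_ `]a, b[).
  apply/(measurable_restrictT _ _).1 => //.
  apply: (@measurable_funS _ _ _ _ (`[a, b]%classic : set R)) => //.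
    exact: subset_itv_oo_cc.
  exact: subspace_continuous_measurable_fun.
have -> : dext = (fun t => (dPsi \_ `]a, b[) t + (1 - \1_(`]a, b[%classic) t)).
  apply/funext => t; rewrite /dext patchE indicE mem_setE in_itv/=.
  by case: ifP; rewrite ?subrr ?addr0 ?subr0 ?add0r.
by apply: measurable_funD => //; apply: measurable_funB.
Qed.

(** This is [intp] for the pair [ext], [dext]. Both sides are additive in the interval, so it can be
    cut at a and b and each piece treated separately. *)
Lemma integral_dext s t : s <= t ->
  (\int[leb]_(u in `]s, t]) (dext u)%:E = (ext t - ext s)%:E)%E.
Proof.
pose C s t := (\int[leb]_(u in `]s, t]) (dext u)%:E = (ext t - ext s)%:E)%E.
have md D : measurable_fun D (fun u => (dext u)%:E).
  by apply/measurable_EFinP; apply: measurable_funTS; exact: measurable_dext.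
have Cadd x y z : x <= y -> y <= z -> C x y -> C y z -> C x z.
  move=> xy yz; rewrite /C => C1 C2.
  rewrite (_ : `]x, z]%classic = `]x, y] `|` `]y, z]); last first.
    by rewrite -itv_bndbnd_setU// bnd_simp.
  rewrite ge0_integral_setU//.
  - by rewrite C1 C2 -EFinD; congr EFin; ring.
  - exact: md.
  - by move=> u _; rewrite lee_fin dext_ge0.
  - apply/disj_setPS => u [] /=; rewrite !in_itv/= => /andP[_ uy] /andP[yu _].
    by move: (lt_le_trans yu uy); rewrite ltxx.
have C1 x y : x <= y -> (forall u, x < u <= y -> dext u = 1) ->
    ext y - ext x = y - x -> C x y.
  move=> xy d1 e1; rewrite /C e1.
  transitivity (\int[leb]_(u in `]x, y]) (cst 1%:E u))%E.
    by apply: eq_integral => u; rewrite inE/= in_itv/= => /d1 ->.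
  rewrite integral_cst//= lebesgue_measure_itv/= lte_fin mul1e.
  case: ltP => xy'; first by rewrite -EFinB.
  have -> : x = y by apply/eqP; rewrite eq_le xy xy'.
  by rewrite subrr.
have lo x y : x <= y -> y <= a -> C x y.
  move=> xy ya; apply: C1 => //.
    by move=> u /andP[_ uy]; rewrite /dext ltNge (le_trans uy ya).
  by rewrite !ext_le ?(le_trans xy)//; ring.
have hi x y : b <= x -> x <= y -> C x y.
  move=> bx xy; apply: C1 => //.
    move=> u /andP[xu _]; rewrite /dext [u < b]ltNge (le_trans bx (ltW xu)).
    by rewrite andbF.
  by rewrite !ext_ge ?(le_trans bx)//; ring.
have mid x y : a <= x -> x <= y -> y <= b -> C x y.
  move=> ax; rewrite le_eqVlt => /predU1P[<- _|xy yb].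
    by rewrite /C subrr set_itvoc0 integral_set0.
  have sub : `[x, y] `<=` `[a, b] by apply: subset_itvScc; rewrite bnd_simp.
  have cx : {within `[x, y], continuous Psi} by exact: continuous_subspaceW cPsi.
  have [cx1 cx2 cx3] := (continuous_within_itvP Psi xy).1 cx.
  rewrite /C.
  (* Endpoints are discarded as null sets, since [dext] may differ from [dPsi] at a and b. *)
  transitivity (\int[leb]_(u in `[x, y]) (dPsi u)%:E)%E.
    rewrite (@integral_itv_bndoo _ x y _ false false)//.
    rewrite (@integral_itv_bndoo _ x y _ true false)//; last first.
      apply/measurable_EFinP.
      apply: (@measurable_funS _ _ _ _ (`[a, b]%classic : set R)) => //.
        by apply: subset_trans sub; exact: subset_itv_oo_cc.
      exact: subspace_continuous_measurable_fun.
    apply: eq_integral => u; rewrite inE/= in_itv/= => /andP[xu uy].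
    by rewrite /dext (le_lt_trans ax xu) (lt_le_trans uy yb).
  rewrite (@continuous_FTC2 _ dPsi Psi)//.
  - rewrite -EFinB; congr EFin; rewrite !ext_in; [ring| |].
      by rewrite ax (le_trans (ltW xy)).
    by rewrite yb (le_trans ax)// ltW.
  - exact: continuous_subspaceW cdPsi.
  - split => // u; rewrite in_itv/= => /andP[xu uy]; apply: dPsi1.
    by rewrite (le_lt_trans ax xu) (lt_le_trans uy yb).
  - move=> u; rewrite in_itv/= => /andP[xu uy]; apply: dPsiE.
    by rewrite (le_lt_trans ax xu) (lt_le_trans uy yb).
have lomid x y : x <= y -> y <= b -> C x y.
  move=> xy yb; case: (leP a x) => xa; first exact: mid.
  case: (leP y a) => ya; first exact: lo.
  by apply: (Cadd x a y (ltW xa) (ltW ya)); [exact: lo (ltW xa) _|exact: mid (ltW ya) _].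
move=> st; rewrite -/(C s t); case: (leP t b) => tb; first exact: lomid.
case: (leP b s) => sb; first exact: hi.
by apply: (Cadd s b t (ltW sb) (ltW tb)); [exact: lomid (ltW sb) _|exact: hi (ltW tb)].
Qed.

Definition iext : R -> R := projT1 (choice ext_surj).

Lemma iextE x : ext (iext x) = x.
Proof. exact: (projT2 (choice ext_surj)). Qed.

Lemma ext_inj : injective ext.
Proof. exact: inc_inj ext_mono. Qed.

Lemma iextK t : iext (ext t) = t.
Proof. by apply: ext_inj; rewrite iextE. Qed.

Lemma ext_lt x y : (ext x < ext y) = (x < y).
Proof. by rewrite !ltNge ext_mono. Qed.

Lemma iext_continuous : continuous iext.
Proof.
move=> x; apply/cvgrPdist_lt => e e0; near=> y.
have h1 : ext (iext x - e) < y.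
  by near: y; apply: lt_nbhsr; rewrite -{2}(iextE x) ext_lt gtrBl.
have h2 : y < ext (iext x + e).
  by near: y; apply: lt_nbhsl; rewrite -{1}(iextE x) ext_lt ltrDl.
rewrite -(iextE y) !ext_lt in h1 h2.
by rewrite ltr_norml; apply/andP; split; lra.
Unshelve. all: by end_near. Qed.

Lemma exta : ext a = 0. Proof. by rewrite ext_le// subrr. Qed.
Lemma extb : ext b = X. Proof. by rewrite ext_ge// subrr addr0. Qed.

Lemma iext_oo x : 0 < x < X -> a < iext x < b.
Proof. by rewrite -exta -extb -{1 2}(iextE x) !ext_lt. Qed.

Lemma iext_oc x : 0 < x <= X -> a < iext x <= b.
Proof. by rewrite -exta -extb -{1 2}(iextE x) ext_lt ext_mono. Qed.

Lemma ext_oo t : a < t < b -> 0 < ext t < X.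
Proof. by rewrite -exta -extb !ext_lt. Qed.

Lemma ext_oc t : a < t <= b -> 0 < ext t <= X.
Proof. by rewrite -exta -extb ext_lt ext_mono. Qed.

Lemma ext_is_derive t : a < t < b -> is_derive t 1 ext (dPsi t).
Proof.
move=> tab; have [ta tb] := andP tab.
apply: (@near_eq_is_derive _ _ _ (fun s => Psi s - Psi a)).
  near=> s; rewrite ext_in//; apply/andP; split; apply: ltW.
    by near: s; exact: lt_nbhsr.
  by near: s; exact: lt_nbhsl.
rewrite -[dPsi t]subr0; apply: is_deriveB; exact: Psi_is_derive.
Unshelve. all: by end_near. Qed.

Lemma iext_is_derive x : 0 < x < X -> is_derive x 1 iext (dPsi (iext x))^-1.
Proof.
move=> xX; have tab := iext_oo xX; have [ta tb] := andP tab.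
rewrite -{1}(iextE x); apply: is_derive_inverse.
- by near=> s; exact: iextK.
- near=> s.
  have sab : a < s < b.
    by apply/andP; split; near: s; [exact: lt_nbhsr|exact: lt_nbhsl].
  apply: differentiable_continuous; apply/derivable1_diffP.
  by have ds := ext_is_derive sab; exact: ex_derive.
- exact: ext_is_derive.
- by rewrite dPsi_neq0 ?(ltW ta) ?(ltW tb).
Unshelve. all: by end_near. Qed.

Definition clampab (t : R) : R := Num.max a (Num.min t b).

Lemma clampab_in t : a <= clampab t <= b.
Proof. by rewrite /clampab le_max lexx/= ge_max ge_min lexx orbT ltW. Qed.

Lemma clampab_id t : a <= t <= b -> clampab t = t.
Proof. by move=> /andP[ta tb]; rewrite /clampab min_l// max_r. Qed.

Lemma continuous_clampab (F : R -> R) : {within `[a, b], continuous F} ->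
  continuous (F \o clampab).
Proof.
move=> /subspace_continuousP cF t.
have cc : clampab @ t --> clampab t.
  apply: (@continuous_max _ _ (fun=> a) (fun x => Num.min x b) t); first exact: cvg_cst.
  by apply: (@continuous_min _ _ id (fun=> b) t); [exact: cvg_id|exact: cvg_cst].
have tin : `[a, b]%classic (clampab t) by rewrite /= in_itv/= clampab_in.
apply: (@cvg_comp _ _ _ clampab F _ (within `[a, b] (nbhs (clampab t)))); last exact: cF.
move=> P wP; have := cc _ wP; apply: (@filterS _ (nbhs t)) => s; apply.
by rewrite /= in_itv/= clampab_in.
Qed.

Definition pull (h : R -> R) (x : R) : R := if 0 < x <= X then h (iext x) else 0.

Lemma pull_ext h t : a < t <= b -> pull h (ext t) = h t.
Proof. by move=> tab; rewrite /pull ext_oc// iextK. Qed.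

Lemma wspace_pull g h : wspace Psi a b g h -> wcont X g (pull h).
Proof.
move=> [F [cF hF]].
apply: (@wcont_local _ X X_gt0 g _ ((F \o clampab) \o iext)).
- by move=> x /negbTE xX; rewrite /pull xX.
- move=> x _; apply: continuous_comp; first exact: iext_continuous.
  exact: continuous_clampab.
- move=> x xX; have tab := iext_oc xX; have [ta tb] := andP tab.
  rewrite /= clampab_id ?(ltW ta)// hF// /pull xX; congr (_ `^ _ * _).
  by rewrite -ext_in ?(ltW ta)// iextE.
Qed.

Lemma wcont_wspace g h : wcont X g h -> wspace Psi a b g (h \o ext).
Proof.
move=> [_ [F [M [cF _ hF]]]]; exists (F \o (fun t => Psi t - Psi a)); split.
  apply/subspace_continuousP => t tab.
  apply: (@cvg_comp _ _ _ (fun s => Psi s - Psi a) F _ (nbhs (Psi t - Psi a))).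
    apply: cvgB; last exact: cvg_cst.
    by move/subspace_continuousP : cPsi; exact.
  exact: cF.
move=> t tab; have [ta tb] := andP tab.
by rewrite /= -ext_in ?(ltW ta)// hF// ext_oc.
Qed.

(** * Fractional integrals under the change of variable *)

Section kernel_integral.
Variables (al t : R) (h hc : R -> R).
Hypotheses (al0 : 0 < al) (tab : a < t <= b).
Hypothesis mhc : measurable_fun [set: R] hc.
Hypothesis hc0 : forall x, x <= 0 -> hc x = 0.
Hypothesis hcE : forall s, a < s < t -> hc (ext s) = h s.

Let phi (s : R) : R := derive1 Psi s * (Psi t - Psi s) `^ (al - 1) * h s.

(** Outside ]a, t[ the left side vanishes too: below a because of [hc], from t on because of the
    kernel. *)
Let integrandE (s : R) :
  rlk al (ext t - ext s) * hc (ext s) * dext s = (Gamma al)^-1 * (phi \_ `]a, t[) s.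
Proof.
have [ta tb] := andP tab; rewrite patchE mem_setE in_itv/=.
case: (leP s a) => sa.
  by rewrite hc0 ?mulr0 ?mul0r// -exta ext_mono.
case: (ltP s t) => st; last by rewrite rlk0 ?mulr0 ?mul0r// subr_le0 ext_mono.
have sab : a < s < b by rewrite sa (lt_le_trans st).
rewrite /= hcE ?sa// /dext sab /phi dPsiE//.
rewrite rlk_gt0E ?subr_gt0 ?ext_lt// !ext_in ?(ltW ta) ?(ltW sa) ?(le_trans (ltW st))//.
have -> : Psi t - Psi a - (Psi s - Psi a) = Psi t - Psi s by ring.
by rewrite mulrC; move: (_ `^ _) (Gamma _)^-1 => p q; ring.
Qed.

Let mint : measurable_fun [set: R]
  (fun s => rlk al (ext t - ext s) * hc (ext s) * dext s).
Proof.
have mext : measurable_fun [set: R] ext.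
  by apply: nondecreasing_measurable => // x y; rewrite ext_mono.
apply: measurable_funM; last exact: measurable_dext.
apply: measurable_funM; last exact: (measurableT_comp mhc).
apply: (measurableT_comp (@measurable_rlk R al)).
exact: measurable_funB.
Qed.

Let mphi : measurable_fun [set: R] (phi \_ `]a, t[).
Proof.
have -> : phi \_ `]a, t[ = (fun s => Gamma al * (rlk al (ext t - ext s) * hc (ext s) * dext s)).
  by apply/funext => s; rewrite integrandE mulVKf// gt_eqF// Gamma_gt0.
exact: measurable_funM.
Qed.

(** [hc] has to match [h] on ]a, t[ only, so that the same statement serves for ystar, for its
    derivative [w] and for f along the solution. *)
Lemma RL_int_RL : RL_int Psi a al h t = RL al hc (ext t).
Proof.
rewrite /RL_int gt_eqF// /RL.
have -> : \int[leb]_y (rlk al (ext t - y) * hc y) =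
    \int[leb]_s ((Gamma al)^-1 * (phi \_ `]a, t[) s).
  rewrite /Rintegral (integral_change_of_variable ext_mono ext_surj measurable_dext
    dext_ge0 integral_dext); last exact: measurable_rlk_mul.
  by congr fine; apply: eq_integral => s _; rewrite integrandE.
rewrite RintegralZl_ge0//; congr (_ * _).
rewrite -Rintegral_mkcond /Rintegral; congr fine.
apply: (@integral_itv_bndoo R a t (EFin \o phi) true false).
apply/measurable_EFinP; apply/(measurable_restrictT _ _).2 => //.
Qed.

Lemma RL_integrable_ext : leb.-integrable `[a, t] (EFin \o phi) -> RL_integrable al hc (ext t).
Proof.
move=> /integrableP[_ iphi]; apply/integrableP; split.
  by apply/measurable_EFinP; exact: measurable_rlk_mul.
have mk : measurable_fun [set: R] (fun y => (`|rlk al (ext t - y) * hc y|)%:E).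
  by apply/measurable_EFinP; apply: measurableT_comp => //; exact: measurable_rlk_mul.
rewrite (ge0_integral_change_of_variable ext_mono ext_surj measurable_dext
    dext_ge0 integral_dext)//.
apply: (@le_lt_trans _ _ (\int[leb]_s (((Gamma al)^-1)%:E * `|(phi \_ `]a, t[) s|%:E))%E).
  rewrite le_eqVlt; apply/orP; left; apply/eqP; apply: eq_integral => s _.
  rewrite /= -!EFinM; congr EFin.
  rewrite -[dext s]ger0_norm ?dext_ge0// -normrM integrandE normrM ger0_norm//.
  by rewrite invr_ge0 ltW// Gamma_gt0.
have mn : measurable_fun [set: R] (fun s => (`|(phi \_ `]a, t[) s|)%:E).
  by apply/measurable_EFinP; apply: measurableT_comp.
rewrite ge0_integralZl//; last by rewrite lee_fin invr_ge0 ltW// Gamma_gt0.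
apply: lte_mul_pinfty => //; first by rewrite lee_fin invr_ge0 ltW// Gamma_gt0.
apply: le_lt_trans iphi.
rewrite (@integral_itv_bndoo _ a t (fun s => `|(EFin \o phi) s|%E) true false); last first.
  apply: measurableT_comp => //; apply/measurable_EFinP.
  exact/(measurable_restrictT _ _).2.
rewrite [leRHS]integral_mkcond; rewrite le_eqVlt; apply/orP; left.
by apply/eqP; apply: eq_integral => s _; rewrite !patchE; case: ifP => // _; rewrite normr0.
Qed.

End kernel_integral.

(** Agreement is required at s = t as well because order 0 evaluates the function there. *)
Lemma RL_int_RL0 (al t : R) (h hc : R -> R) : 0 <= al -> a < t <= b ->
  measurable_fun [set: R] hc -> (forall x, x <= 0 -> hc x = 0) ->
  (forall s, a < s <= t -> hc (ext s) = h s) ->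
  RL_int Psi a al h t = RL0 al hc (ext t).
Proof.
rewrite le_eqVlt => /predU1P[<- /andP[ta tb] _ _ hcE|al0 tab mhc hc0 hcE].
  by rewrite /RL_int /RL0 eqxx hcE// ta lexx.
rewrite /RL0 gt_eqF//; apply: RL_int_RL => // s /andP[sa st].
by rewrite hcE// sa ltW.
Qed.

(** * The stability estimate in the original variable *)

Section stability.
Variables (mu nu L eps : R) (f : R -> R -> R) (ystar : R -> R).
Hypotheses (mu01 : 0 < mu < 1) (nu01 : 0 <= nu <= 1).
Let be := nu * (1 - mu).
Let rho := mu + be.
Hypothesis fW : forall y : R -> R, wspace Psi a b (1 - rho) y ->
  wspace Psi a b (1 - rho) (fun t => f t (y t)).
Hypothesis L0 : 0 < L.
Hypothesis fL : forall t y1 y2, a < t <= b -> `|f t y1 - f t y2| <= L * `|y1 - y2|.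
Hypothesis eps0 : 0 < eps.
Hypothesis yW : wspace Psi a b (1 - rho) ystar.
Hypothesis yD : hilfer_derivable Psi a b mu nu ystar.
Hypothesis yH : forall t, a < t < b ->
  `|hilfer_deriv Psi a mu nu ystar t - f t (ystar t)| <= eps.

Let ga := (1 - nu) * (1 - mu).

Let gaE : ga = 1 - rho. Proof. by rewrite /ga /rho /be; ring. Qed.

Let mu0 : 0 < mu. Proof. by case/andP: mu01. Qed.

Let be0 : 0 <= be.
Proof. by rewrite mulr_ge0 ?subr_ge0; case/andP: nu01 => // _ _; case/andP: mu01 => _ /ltW. Qed.

Let ga0 : 0 <= ga.
Proof. by rewrite mulr_ge0 ?subr_ge0//; [case/andP: nu01|case/andP: mu01 => _ /ltW]. Qed.

Let rho0 : 0 < rho. Proof. by rewrite /rho ltr_pwDl. Qed.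

Let rho1 : rho <= 1. Proof. by rewrite -subr_ge0 -gaE. Qed.

Let ga1 : ga < 1. Proof. by rewrite gaE gtrBl. Qed.

Let X0 : 0 < X := X_gt0.

Definition pullf (x v : R) : R := if 0 < x <= X then f (iext x) v else 0.

Lemma pullf_wcont h :
  wcont X (1 - rho) h -> wcont X (1 - rho) (fun x => pullf x (h x)).
Proof.
move=> /wcont_wspace/fW/wspace_pull; congr (wcont _ _ _); apply/funext => x.
by rewrite /pull /pullf /= iextE.
Qed.

Lemma pullf_lipschitz x u v : `|pullf x u - pullf x v| <= L * `|u - v|.
Proof.
rewrite /pullf; case: ifP => [xX|_]; first by apply: fL; exact: iext_oc.
by rewrite subrr normr0 mulr_ge0// ltW.
Qed.

Let k := pull ystar.
Let fk x := pullf x (k x).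
Let G := RL_int Psi a ga ystar.
(** In the variable x = ext t the operator (1 / Psi') d/dt is d/dx, so this is the derivative of
    I^ga of [k]. *)
Let w x := if 0 < x < X then derive1 G (iext x) / dPsi (iext x) else 0.

Let kW : wcont X (1 - rho) k. Proof. exact: wspace_pull. Qed.

Let fkW : wcont X (1 - rho) fk. Proof. exact: pullf_wcont. Qed.

Let kle0 x : x <= 0 -> k x = 0.
Proof. by move=> x0; rewrite /k /pull ltNge x0. Qed.

Let GE t : a < t <= b -> G t = RL0 ga k (ext t).
Proof.
move=> tab; apply: RL_int_RL0 => //; first exact: wcont_measurable kW.
move=> s /andP[sa st]; rewrite /k pull_ext// sa (le_trans st)//.
by case/andP: tab.
Qed.

Let wD x : 0 < x < X -> is_derive x 1 (RL0 ga k) (w x).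
Proof.
move=> xX; have tab := iext_oo xX; have [x0 xX'] := andP xX.
apply: (@near_eq_is_derive _ _ _ (G \o iext)).
  near=> y; rewrite /= GE ?iextE//; apply: iext_oc.
  apply/andP; split; first by near: y; exact: lt_nbhsr.
  by apply: ltW; near: y; exact: lt_nbhsl.
rewrite /w xX; apply: is_derive1_comp; last exact: iext_is_derive.
by apply: DeriveDef; [exact: (yD tab).1|rewrite derive1E].
Unshelve. all: by end_near. Qed.

Let wm : measurable_fun [set: R] w.
Proof.
have -> : w = (fun x => if 0 < x < X then w x else 0).
  by apply/funext => x; rewrite /w; case: ifP.
apply: measurable_is_derive wD; apply: RL0_measurable => //.
by rewrite gaE.
Qed.

Let wle0 x : x <= 0 -> w x = 0.
Proof. by move=> x0; rewrite /w ltNge x0. Qed.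

Let wE s : a < s < b -> w (ext s) = derive1 G s / derive1 Psi s.
Proof. by move=> sab; rewrite /w ext_oo// iextK dPsiE. Qed.

Let wi : 0 < be -> forall x, 0 < x < X -> RL_integrable be w x.
Proof.
move=> bep x xX; have tab := iext_oo xX; have [ta tb] := andP tab.
rewrite -(iextE x).
apply: (@RL_integrable_ext _ _ (fun s => derive1 G s / derive1 Psi s)) => //.
- by rewrite ta ltW.
- by move=> s /andP[sa st]; rewrite wE// sa (lt_trans st).
- exact: (yD tab).2.
Qed.

Let weps x : 0 < x < X -> `|RL0 be w x - fk x| <= eps.
Proof.
move=> xX; have tab := iext_oo xX; have [ta tb] := andP tab.
have tab' : a < iext x <= b by rewrite ta ltW.
have := yH tab; rewrite /hilfer_deriv -/ga -/G (@RL_int_RL0 _ _ _ w)//.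
  rewrite iextE /fk /pullf /k /pull; case/andP: xX => x0 xX.
  by rewrite x0 (ltW xX).
by move=> s /andP[sa st]; rewrite wE// sa (le_lt_trans st).
Qed.

(** A [lim] can be transported only once convergence is known: it comes from [cvg_RL0_at0], and
    composition with [ext], increasing and right-continuous at a, carries it over. *)
Let init_valE : init_val Psi a (1 - rho) ystar = lim (RL0 ga k x @[x --> 0^'+]).
Proof.
rewrite /init_val -gaE -/G.
have cG : RL0 ga k x @[x --> 0^'+] --> lim (RL0 ga k x @[x --> 0^'+]).
  have := @cvg_RL0_at0 _ X mu be eps k fk w X0 mu0 be0 rho1 fkW wm.
  by rewrite -/rho -gaE; apply.
have ea : ext x @[x --> a^'+] --> ext a.
  rewrite ext_in ?lexx ?ltW//.
  have [_ + _] := (continuous_within_itvP Psi ab).1 cPsi => ca.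
  apply: (@cvg_trans _ ((Psi x - Psi a) @[x --> a^'+])).
    apply: near_eq_cvg; near=> x; rewrite ext_in//.
    by apply/andP; split; apply: ltW; near: x; [exact: nbhs_right_gt|exact: nbhs_right_lt].
  by apply: cvgB => //; exact: cvg_cst.
apply/cvg_lim => //.
apply: (@cvg_trans _ (RL0 ga k (ext x) @[x --> a^'+])).
  apply: near_eq_cvg; near=> x; rewrite GE//.
  by apply/andP; split; [|apply: ltW]; near: x; [exact: nbhs_right_gt|exact: nbhs_right_lt].
apply: (@increasing_cvg_at_right_comp _ ext (RL0 ga k) a +oo%O) => //.
- by move=> x y _ _; exact: ext_incr.
- by rewrite exta.
Unshelve. all: by end_near. Qed.

Lemma hilfer_stability : exists y : R -> R,
  [/\ wspace Psi a b (1 - rho) y,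
      forall t, a < t <= b ->
        y t = (Psi t - Psi a) `^ (rho - 1) / Gamma rho * init_val Psi a (1 - rho) ystar
              + RL_int Psi a mu (fun s => f s (y s)) t
    & forall t, a < t <= b -> `|(Psi t - Psi a) `^ (1 - rho) * (ystar t - y t)|
        <= (mittag_leffler mu (L * X `^ mu) - 1) / L * X `^ (1 - rho) * eps].
Proof.
have wD' := wD; rewrite gaE in wD'.
have res x : 0 < x <= X -> `|k x - (init_val Psi a (1 - rho) ystar * rlk rho x +
    RL mu (fun s => pullf s (k s)) x)| <= eps * rlk (mu + 1) x.
  move=> xX; rewrite init_valE gaE.
  exact: (residual_bound X0 mu0 be0 rho1 kW fkW wm wle0 wD' wi weps xX).
have pullf0 x v : ~~ (0 < x <= X) -> pullf x v = 0 by rewrite /pullf => /negbTE ->.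
have [z [zW zE zB]] := picard_stability X0 mu0 rho0 rho1 L0 (ltW eps0) pullf0
  pullf_wcont pullf_lipschitz kW res.
have fzW := pullf_wcont zW.
exists (z \o ext); split.
- exact: wcont_wspace.
- move=> t tab; have [ta tb] := andP tab; rewrite /= zE ?ext_oc//.
  rewrite rlk_gt0E ?ext_in ?(ltW ta)//; last first.
    by rewrite -ext_in ?(ltW ta)//; case/andP: (ext_oc tab).
  congr (_ + _); first by rewrite mulrC.
  rewrite -ext_in ?(ltW ta)//; apply/esym/RL_int_RL => //.
  + exact: wcont_measurable fzW.
  + by move=> x x0; rewrite pullf0// ltNge x0.
  + move=> s /andP[sa st].
    by rewrite /pullf ext_oc ?iextK// sa (le_trans (ltW st)).
- move=> t tab; have [ta tb] := andP tab; have eX := ext_oc tab.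
  rewrite -ext_in ?(ltW ta)// normrM ger0_norm ?powR_ge0//.
  (* The weight is at most X^(1-rho) as 1 - rho >= 0, and the Picard estimate bounds the other
     factor uniformly. *)
  rewrite -(pull_ext ystar tab) -mulrA [leRHS]mulrCA; apply: ler_pM => //.
  + exact: powR_ge0.
  + case/andP: eX => e0 eX; apply: ge0_ler_powR; rewrite ?nnegrE ?(ltW e0) ?(ltW X0)//.
    by rewrite -gaE.
  + exact: zB.
Qed.

End stability.

End transfer.

Theorem theorem4p1 (R : realType) (a b : R) (Psi dPsi : R -> R)
    (mu nu L : R) (f : R -> R -> R) :
  0 < a -> a < b ->
  (* Psi in C^1([a,b]), increasing, Psi' <> 0 on [a,b] *)
  {within `[a, b], continuous Psi} ->
  (forall t, a < t < b -> derivable Psi t 1) ->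
  {within `[a, b], continuous dPsi} ->
  (forall t, a < t < b -> derive1 Psi t = dPsi t) ->
  (forall t, a <= t <= b -> dPsi t != 0) ->
  (forall x y, a <= x -> x <= y -> y <= b -> Psi x <= Psi y) ->
  0 < mu < 1 -> 0 <= nu <= 1 ->
  let rho := mu + nu - mu * nu in
  (forall y : R -> R, wspace Psi a b (1 - rho) y ->
     wspace Psi a b (1 - rho) (fun t => f t (y t))) ->
  0 < L ->
  (forall t y1 y2, a < t <= b -> `|f t y1 - f t y2| <= L * `|y1 - y2|) ->
  forall eps : R, 0 < eps ->
  forall ystar : R -> R,
    wspace Psi a b (1 - rho) ystar ->
    hilfer_derivable Psi a b mu nu ystar ->
    (forall t, a < t < b ->
       `|hilfer_deriv Psi a mu nu ystar t - f t (ystar t)| <= eps) ->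
    exists y : R -> R,
      wspace Psi a b (1 - rho) y /\
      (forall t, a < t <= b ->
         y t = (Psi t - Psi a) `^ (rho - 1) / Gamma rho
                 * init_val Psi a (1 - rho) ystar
               + RL_int Psi a mu (fun s => f s (y s)) t) /\
      (forall t, a < t <= b ->
         `|(Psi t - Psi a) `^ (1 - rho) * (ystar t - y t)|
           <= (mittag_leffler mu (L * (Psi b - Psi a) `^ mu) - 1) / L
                * (Psi b - Psi a) `^ (1 - rho) * eps).
Proof.
move=> _ ab cPsi dPsi1 cdPsi dPsiE dPsi_neq0 ndPsi mu01 nu01.
have -> : mu + nu - mu * nu = mu + nu * (1 - mu) by ring.
move=> rho fW L0 fL eps eps0 ystar yW yD yH.
have [y [yw yE yB]] := hilfer_stability ab cPsi dPsi1 cdPsi dPsiE dPsi_neq0 ndPsi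
  mu01 nu01 fW L0 fL eps0 yW yD yH.
by exists y.
Qed.
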